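(* Let $A$ be a $C^{*}$-subalgebra of $\mathcal{F}_{n}$. If the relative commutant $A'\cap \mathcal{F}_{n}$ is finite-dimensional, then the algebra $A'\cap \mathcal{O}_{n}$ is also finite-dimensional.
   Context: $\mathcal{O}_{n}$ ($2\le n<\infty$) is the Cuntz algebra, the $C^{*}$-algebra generated by isometries $S_{1},\dots,S_{n}$ satisfying $\sum_{i=1}^{n}S_{i}S_{i}^{*}=1$. The gauge action $\gamma_{z}$ ($z\in\mathbb{T}$) on $\mathcal{O}_{n}$ is the action by automorphisms with $\gamma_{z}(S_{i})=zS_{i}$. $\mathcal{F}_{n}\subset\mathcal{O}_{n}$ is the fixed point algebra of the gauge action; it is isomorphic to the UHF-algebra of type $n^{\infty}$. For $A\subset \mathcal{F}_{n}$ and $C=\mathcal{F}_n$ or $\mathcal{O}_n$, $A'\cap C=\{x\in C : xa=ax \text{ for all } a\in A\}$. *)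

(* Defs.v *)
From HB Require Import structures.
From mathcomp Require Import all_boot all_order all_algebra.
From mathcomp Require Import complex.
From mathcomp Require Import all_classical all_reals all_analysis.
Set Implicit Arguments.
Unset Strict Implicit.
Unset Printing Implicit Defensive.
Import Order.TTheory GRing.Theory Num.Theory.
Import numFieldNormedType.Exports.
Local Open Scope classical_set_scope.
Local Open Scope ring_scope.

(* Unital C*-algebras over the complex numbers R[i], with 1 != 0. The norm is
   valued in R[i], where [0 <= c] says that c is real and nonnegative. The
   product is a record field, not an inherited one, because no structure
   joining rings and normed modules can be added below [numDomainType]; the
   ring and algebra structures are instances on [carrier]. *)
Record cstarAlgType (R : realType) := CStarAlgType {
  banach_space : completeNormedModType R[i];
  #[canonical=no] cstar_one : banach_space;
  #[canonical=no] cstar_mul : banach_space -> banach_space -> banach_space;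
  #[canonical=no] cstar_star : banach_space -> banach_space;
  #[canonical=no] cstar_mulA : associative cstar_mul;
  #[canonical=no] cstar_mul1l : left_id cstar_one cstar_mul;
  #[canonical=no] cstar_mul1r : right_id cstar_one cstar_mul;
  #[canonical=no] cstar_mulDl : left_distributive cstar_mul +%R;
  #[canonical=no] cstar_mulDr : right_distributive cstar_mul +%R;
  #[canonical=no] cstar_one_neq0 : cstar_one != 0;
  #[canonical=no] cstar_scaleAl :
    forall (c : R[i]) x y, c *: cstar_mul x y = cstar_mul (c *: x) y;
  #[canonical=no] cstar_scaleAr :
    forall (c : R[i]) x y, c *: cstar_mul x y = cstar_mul x (c *: y);
  #[canonical=no] cstar_starD : {morph cstar_star : x y / x + y};
  #[canonical=no] cstar_starZ :
    forall (c : R[i]) x, cstar_star (c *: x) = c^* *: cstar_star x;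
  #[canonical=no] cstar_starM :
    forall x y, cstar_star (cstar_mul x y)
                = cstar_mul (cstar_star y) (cstar_star x);
  #[canonical=no] cstar_starK : involutive cstar_star;
  #[canonical=no] cstar_normM :
    forall x y, `|cstar_mul x y| <= `|x| * `|y|;
  #[canonical=no] cstar_norm_star :
    forall x, `|cstar_mul (cstar_star x) x| = `|x| ^+ 2
}.

Definition carrier (R : realType) (A : cstarAlgType R) : Type :=
  banach_space A.
Coercion carrier : cstarAlgType >-> Sortclass.

HB.instance Definition _ (R : realType) (A : cstarAlgType R) :=
  CompleteNormedModule.copy (carrier A) (banach_space A).
HB.instance Definition _ (R : realType) (A : cstarAlgType R) :=
  GRing.Zmodule_isNzRing.Build (carrier A) (@cstar_mulA R A)
    (@cstar_mul1l R A) (@cstar_mul1r R A) (@cstar_mulDl R A)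
    (@cstar_mulDr R A) (@cstar_one_neq0 R A).
HB.instance Definition _ (R : realType) (A : cstarAlgType R) :=
  GRing.Lmodule_isLalgebra.Build R[i] (carrier A) (@cstar_scaleAl R A).
HB.instance Definition _ (R : realType) (A : cstarAlgType R) :=
  GRing.Lalgebra_isAlgebra.Build R[i] (carrier A) (@cstar_scaleAr R A).

Section CStar.
Context {R : realType} {A : cstarAlgType R}.

Definition star (x : A) : A := cstar_star x.

Lemma starD (x y : A) : star (x + y) = star x + star y.
Proof. exact: cstar_starD. Qed.

Lemma starZ (c : R[i]) (x : A) : star (c *: x) = c^* *: star x.
Proof. exact: cstar_starZ. Qed.

Lemma starM (x y : A) : star (x * y) = star y * star x.
Proof. exact: cstar_starM. Qed.

Lemma starK : involutive star.
Proof. exact: cstar_starK. Qed.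

Lemma ler_normM (x y : A) : `|x * y| <= `|x| * `|y|.
Proof. exact: cstar_normM. Qed.

Lemma normM_star (x : A) : `|star x * x| = `|x| ^+ 2.
Proof. exact: cstar_norm_star. Qed.

(* A C*-subalgebra need not contain the unit of A. *)
Definition cstar_subalgebra (B : set A) : Prop :=
  [/\ closed B,
      B 0 /\ (forall x y, B x -> B y -> B (x + y)),
      forall (c : R[i]) x, B x -> B (c *: x),
      forall x y, B x -> B y -> B (x * y)
    & forall x, B x -> B (star x)].

Definition star_automorphism (f : A -> A) : Prop :=
  [/\ bijective f,
      forall (c : R[i]) x y, f (c *: x + y) = c *: f x + f y,
      f 1 = 1, {morph f : x y / x * y} & {morph f : x / star x}].

Definition relative_commutant (B C : set A) : set A :=
  [set x | C x /\ forall a, B a -> x * a = a * x].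

(* V is the linear span of finitely many vectors. *)
Definition finite_dimensional (V : set A) : Prop :=
  exists (d : nat) (v : 'I_d -> A),
    V = range (fun c : 'I_d -> R[i] => \sum_i c i *: v i).

(* By Cuntz's uniqueness theorem, for 2 <= n this determines (A, S) up to a
   unique isomorphism. *)
Definition cuntz_algebra n (S : 'I_n -> A) : Prop :=
  [/\ forall i, star (S i) * S i = 1,
      \sum_i S i * star (S i) = 1
    & smallest cstar_subalgebra (range S) = setT].

(* The circle is {z | `|z| = 1}; values of gamma off the circle are
   irrelevant. *)
Definition gauge_action n (S : 'I_n -> A) (gamma : R[i] -> A -> A) : Prop :=
  [/\ forall z, `|z| = 1 -> star_automorphism (gamma z),
      forall x, gamma 1 x = x,
      forall z w x, `|z| = 1 -> `|w| = 1 ->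
        gamma (z * w) x = gamma z (gamma w x)
    & forall z i, `|z| = 1 -> gamma z (S i) = z *: S i].

Definition fixed_point_algebra (gamma : R[i] -> A -> A) : set A :=
  [set x | forall z, `|z| = 1 -> gamma z x = x].

End CStar.

(* Main.v *)
(* Let p_1, ..., p_r be minimal projections with sum 1 of the finite-dimensional
   algebra B_0 = A' /\ F_n, and B = A' /\ O_n. If x <> 0 in p_i B p_j has gauge
   degree k, then x x^* and x^* x lie in B_0, hence are the same multiple of p_i
   and of p_j. The trace tau of F_n satisfies tau(x y) = n^(-k) tau(y x) for x of
   degree k and y of degree -k, so tau(p_i) = n^(-k) tau(p_j); as tau is
   faithful, k is determined by (i, j). Minimality makes the degree k part of
   p_i B p_j one-dimensional, and an element all of whose Fourier coefficients
   for the gauge action vanish is 0. Hence dim p_i B p_j <= 1 and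
   dim B <= r^2. *)
Require Import Defs.
From HB Require Import structures.
From mathcomp Require Import all_boot all_order all_algebra.
From mathcomp Require Import complex.
From mathcomp Require Import all_classical all_reals all_analysis.
From mathcomp Require Import ring lra zify.
Set Implicit Arguments.
Unset Strict Implicit.
Unset Printing Implicit Defensive.
Import Order.TTheory GRing.Theory Num.Theory.
Import numFieldNormedType.Exports.
Local Open Scope classical_set_scope.
Local Open Scope ring_scope.
Local Open Scope complex_scope.

(** The algebra comes with neither functional calculus nor an order. Norm bounds are drawn from
    unitaries instead: a self-adjoint [a] has norm at most 1 as soon as [a * a + b * b = 1] for a
    commuting self-adjoint [b], and such a [b] is a square root found by iteration. The price is a
    factor: automorphisms are only seen to satisfy |f x| <= 2 |x|, which is enough for all limits.
    The gauge action carries no continuity in [z], so there is no integral over the circle. Averages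
    over the [2 ^ m]-th roots of unity replace it: on a polynomial in the generators they are
    eventually constant in [m], and the bound 2 together with density carries convergence to all of
    O_n. The trace is replaced by a relation, tau(z) = 0, meaning that iterated averages of z come
    arbitrarily close to 0. Linearity, positivity on squares and the commutation rule pass to this
    relation. Faithfulness enters for projections: two different degrees in one corner would make a
    nonzero p_j null. *)

(* `|x| takes its values in R[i]; nm x is the same number in the ordered field
   R. *)
Definition nm (R : realType) (V : normedZmodType R[i]) (x : V) : R :=
  complex.Re `|x|.

(** * Norms and *-homomorphisms *)

Section RealNorm.
Context {R : realType} {V : normedZmodType R[i]}.
Implicit Types x y : V.

Lemma nmE x : `|x| = (nm x)%:C.
Proof.
have := normr_ge0 x; rewrite lecE /nm => /andP[/eqP + _].
by case: `|x| => a b /= ->.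
Qed.

Lemma nm_ge0 x : 0 <= nm x.
Proof. by have := normr_ge0 x; rewrite nmE lecR. Qed.

Lemma nm_eq0 x : nm x = 0 -> x = 0.
Proof. by move=> x0; apply/eqP; rewrite -normr_eq0 nmE x0. Qed.

Lemma nm0 : nm (0 : V) = 0.
Proof. by rewrite /nm normr0. Qed.

Lemma nmD x y : nm (x + y) <= nm x + nm y.
Proof. by have := ler_normD x y; rewrite !nmE -rmorphD lecR. Qed.

Lemma nmN x : nm (- x) = nm x.
Proof. by rewrite /nm normrN. Qed.

Lemma nmB x y : nm (x - y) = nm (y - x).
Proof. by rewrite -nmN opprB. Qed.

Lemma nm_sum (I : Type) (r : seq I) (P : pred I) (F : I -> V) :
  nm (\sum_(i <- r | P i) F i) <= \sum_(i <- r | P i) nm (F i).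
Proof.
elim/big_rec2: _ => [|i y x _ xy]; first by rewrite nm0.
by apply: le_trans (nmD _ _) _; rewrite lerD2l.
Qed.

Lemma nm_small x : (forall e : R, 0 < e -> nm x < e) -> x = 0.
Proof.
move=> small; apply: nm_eq0; apply/eqP; rewrite eq_le nm_ge0 andbT leNgt.
by apply/negP => /small; rewrite ltxx.
Qed.

Lemma nm_trans x y z : nm (x - z) <= nm (x - y) + nm (y - z).
Proof. by rewrite -{1}(subrKA y) nmD. Qed.
End RealNorm.

Section Modulus.
Context {R : realType}.
Implicit Types c d : R[i].

Lemma nm_scalarM c d : nm (c * d) = nm c * nm d.
Proof. by apply: (@complexI R); rewrite rmorphM -!nmE normrM. Qed.

Lemma nm_real (a : R) : 0 <= a -> nm a%:C = a.
Proof. by move=> a0; rewrite /nm ger0_norm ?lecR. Qed.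

Lemma nm_conj c : nm c^*%R = nm c.
Proof. by rewrite /nm norm_conjC. Qed.

Lemma nm_scalarV c : nm c^-1 = (nm c)^-1.
Proof. by apply: (@complexI R); rewrite fmorphV -!nmE normfV. Qed.

Lemma nm_nat k : nm (k%:R : R[i]) = k%:R.
Proof. by rewrite /nm normr_nat -(rmorph_nat (real_complex R)). Qed.

Lemma small_powers (r e : R) : 0 <= r -> r < 1 -> 0 < e -> exists k, r ^+ k < e.
Proof.
move=> r0 r1 e0.
have /cvgrPdist_lt/(_ e e0)[k _ ke] : r ^+ m @[m --> \oo] --> (0 : R).
  by apply: cvg_expr; rewrite ger0_norm.
by exists k; have := ke k (leqnn k); rewrite /= sub0r normrN ger0_norm ?exprn_ge0.
Qed.
End Modulus.

Section CstarNorm.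
Context {R : realType} {A : cstarAlgType R}.
Implicit Types x y z : A.

Lemma nmM x y : nm (x * y) <= nm x * nm y.
Proof. by have := ler_normM x y; rewrite !nmE -rmorphM lecR. Qed.

Lemma nmZ (c : R[i]) x : nm (c *: x) = nm c * nm x.
Proof. by apply: (@complexI R); rewrite rmorphM /= -[LHS]nmE normrZ; congr (_ * _); apply: nmE. Qed.

Lemma nm_cstar x : nm (star x * x) = nm x ^+ 2.
Proof. by apply: (@complexI R); rewrite rmorphXn /= -[LHS]nmE normM_star; congr (_ ^+ 2); apply: nmE. Qed.

Lemma nm_star x : nm (star x) = nm x.
Proof.
have le_star y : nm y <= nm (star y).
  have [->|y0] := eqVneq (nm y) 0; first exact: nm_ge0.
  rewrite -(ler_pM2r (x := nm y)) ?lt_def ?y0 ?nm_ge0 //.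
  by rewrite -expr2 -nm_cstar nmM.
by apply/eqP; rewrite eq_le le_star andbT; have := le_star (star x); rewrite starK.
Qed.

Lemma star0 : star (0 : A) = 0.
Proof. by apply: (addIr (star 0)); rewrite -starD !add0r. Qed.

Lemma star1 : star (1 : A) = 1.
Proof. by rewrite -[RHS]starK -[in RHS](mulr1 (star 1)) starM starK mulr1. Qed.

Lemma starN x : star (- x) = - star x.
Proof. by apply/eqP; rewrite -addr_eq0 -starD addNr star0. Qed.

Lemma starB x y : star (x - y) = star x - star y.
Proof. by rewrite starD starN. Qed.

Lemma star_sum (I : Type) (r : seq I) (P : pred I) (F : I -> A) :
  star (\sum_(i <- r | P i) F i) = \sum_(i <- r | P i) star (F i).
Proof. by elim/big_rec2: _ => [|i x y _ <-]; rewrite ?star0 ?starD. Qed.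

Lemma nm_isometry x : star x * x = 1 -> nm x = 1.
Proof.
have nm1 : nm (1 : A) = 1.
  have n0 : nm (1 : A) != 0.
    by apply/eqP => /nm_eq0 /eqP; rewrite oner_eq0.
  by apply: (mulfI n0); rewrite -expr2 -nm_cstar star1 !mulr1.
move=> xx; apply/eqP; rewrite -(eqrXn2 (n := 2)) ?nm_ge0 //.
by rewrite -nm_cstar xx nm1 expr1n.
Qed.

Lemma nm1 : nm (1 : A) = 1.
Proof. by apply: nm_isometry; rewrite star1 mulr1. Qed.

(** Membership in the norm closure, with a real [e] so that estimates are left to linear arithmetic
    over [R]. *)
Definition approached (B : A -> Prop) x :=
  forall e : R, 0 < e -> exists2 y, B y & nm (x - y) < e.

Lemma approached_closed (B : set A) : closed (approached B).
Proof.
rewrite closure_id; apply/seteqP; split; first exact: subset_closure.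
move=> x cx e e0.
have e20 : 0 < (e / 2)%:C :> R[i] by rewrite ltcR; lra.
have [y [By xy]] := cx _ (nbhsx_ballx x _ e20).
have [z Bz yz] := By (e / 2) (ltac:(lra)).
exists z => //; apply: le_lt_trans (nm_trans x y z) _.
move: xy; rewrite -ball_normE /= nmE ltcR; lra.
Qed.

Definition tends (u : nat -> A) x :=
  forall e : R, 0 < e -> exists M, forall m, (M <= m)%N -> nm (u m - x) < e.

Lemma tends_uniq u x y : tends u x -> tends u y -> x = y.
Proof.
move=> ux uy; apply/eqP; rewrite -subr_eq0; apply/eqP; apply: nm_small => e e0.
have [M uM] := ux (e / 2) (ltac:(lra)); have [K uK] := uy (e / 2) (ltac:(lra)).
have := uM (M + K)%N (leq_addr _ _); have := uK (M + K)%N (leq_addl _ _).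
have := nm_trans x (u (M + K)%N) y; rewrite (nmB x (u _)); lra.
Qed.

(** The one place where completeness of the algebra enters; a positive element of [R[i]] is real, so
    real tolerances suffice. *)
Lemma cauchy_tends (u : nat -> A) :
  (forall e : R, 0 < e -> exists M, forall m k, (M <= m)%N -> (M <= k)%N ->
     nm (u m - u k) < e) ->
  exists x, tends u x.
Proof.
move=> cu.
have realE (e : R[i]) : 0 < e -> e = (complex.Re e)%:C /\ 0 < complex.Re e.
  by case: e => a b; rewrite ltcE /= => /andP[/eqP -> ->].
have /cauchy_cvg ul : cauchy (u @ \oo).
  apply/cauchy_exP => e /realE[-> e0]; have [M uM] := cu _ e0.
  exists (u M); exists M => // m /= Mm.
  by rewrite -ball_normE /= nmE ltcR; apply: uM.
exists (lim (u @ \oo)) => e e0.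
have eC : 0 < e%:C :> R[i] by rewrite ltcR.
have [M _ uM] := (cvgrPdist_lt _ _).1 ul _ eC.
by exists M => m Mm; have := uM m Mm; rewrite /= nmE ltcR nmB.
Qed.
End CstarNorm.

(** * Square roots, unitaries and norm bounds *)

Section Contraction.
Context {R : realType} {A : cstarAlgType R}.
Implicit Types a b t x y z : A.

Lemma nm_half (x : A) : nm ((2^-1 : R[i]) *: x) = nm x / 2.
Proof. by rewrite nmZ nm_scalarV nm_nat mulrC. Qed.

Lemma scale_half_double (x : A) : (2^-1 : R[i]) *: (x + x) = x.
Proof. by rewrite -mulr2n -[x *+ 2](@scaler_nat R[i]) scalerA mulVf ?scale1r // pnatr_eq0. Qed.

Lemma star_half (x : A) : star ((2^-1 : R[i]) *: x) = (2^-1 : R[i]) *: star x.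
Proof. by rewrite starZ fmorphV rmorph_nat. Qed.

Lemma tends_closed (f : A -> A) (K : R) u x :
  (forall y z, nm (f y - f z) <= K * nm (y - z)) ->
  (forall m, f (u m) = u m) -> tends u x -> f x = x.
Proof.
move=> fK fu ux; apply: (tends_uniq _ ux) => e e0.
have K0 : 0 <= `|K| by [].
have [M uM] := ux (e / (`|K| + 1)) (divr_gt0 e0 (ltr_wpDl K0 ltr01)).
exists M => m /uM; rewrite -{2}fu ltr_pdivlMr ?ltr_wpDl // => ume.
apply: le_lt_trans (fK _ _) _; apply: le_lt_trans ume.
have := nm_ge0 (u m - x); have := ler_norm K; nra.
Qed.

(* b = 1 - c, where c is the fixed point of c |-> (x + c^2) / 2. *)
Lemma sqrt_one_sub x : star x = x -> nm x < 1 ->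
  exists b, [/\ star b = b, forall y, x * y = y * x -> b * y = y * b
               & b * b = 1 - x].
Proof.
move=> sx; set r := nm x => r1; have r0 : 0 <= r := nm_ge0 x.
pose f c : A := (2^-1 : R[i]) *: (x + c * c).
pose c k := iter k f 0.
(* The ball of radius [r] is stable under [f] because r + r^2 <= 2 r, and [f] is [r]-Lipschitz there
   since each of the two terms in [fB] contributes a factor [r]. *)
have nc k : nm (c k) <= r.
  elim: k => [|k IH]; first by rewrite nm0.
  rewrite /c iterS nm_half; have := nmD x (c k * c k); rewrite -/r.
  have := nmM (c k) (c k); have := nm_ge0 (c k); rewrite -/(c k); nra.
have fB y z : f y - f z = (2^-1 : R[i]) *: (y * (y - z) + (y - z) * z).
  by rewrite -scalerBr mulrBr mulrBl subrKA opprD addrACA subrr add0r.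
have fL y z : nm y <= r -> nm z <= r -> nm (f y - f z) <= r * nm (y - z).
  move=> ny nz; rewrite fB nm_half.
  have := nmD (y * (y - z)) ((y - z) * z).
  have := nmM y (y - z); have := nmM (y - z) z; have := nm_ge0 (y - z); nra.
have cj k j : nm (c (k + j)%N - c k) <= r ^+ k.
  elim: k => [|k IH]; first by rewrite subr0 expr0; have := nc (0 + j)%N; lra.
  rewrite /c addSn !iterS exprS; apply: le_trans (fL _ _ (nc _) (nc _)) _.
  by apply: ler_wpM2l.
have [l cl] : exists l, tends c l.
  apply: cauchy_tends => e e0; have [M eM] := small_powers r0 r1 (divr_gt0 e0 (ltr0Sn R 1)).
  exists M => m k Mm Mk.
  have := cj M (m - M)%N; have := cj M (k - M)%N; rewrite !subnKC //.
  have := nm_trans (c m) (c M) (c k); rewrite (nmB (c M)); lra.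
have nl : nm l <= r.
  rewrite leNgt; apply/negP => lt.
  have [M lM] := cl (nm l - r) (ltac:(lra)).
  have := lM M (leqnn _); have := nc M; have := nm_trans l (c M) 0.
  by rewrite !subr0 nmB; lra.
have fl : f l = l.
  apply: (tends_uniq _ cl) => e e0; have [M lM] := cl e e0.
  exists M.+1 => -[//|m] Mm; rewrite /c iterS -/(c m).
  have := fL _ _ (nc m) nl; have := lM m Mm; have := nm_ge0 (c m - l); nra.
have sl : star l = l.
  apply: (tends_closed (f := @star R A) (K := 1) _ _ cl) => [y z|m].
    by rewrite -starB nm_star mul1r.
  elim: m => [|m IH]; first by rewrite star0.
  by rewrite /c iterS star_half starD !starM sx -/(c m) IH.
have yl y : x * y = y * x -> l * y = y * l.
  move=> xy; apply/eqP; rewrite -subr_eq0; apply/eqP.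
  have yc m : y * c m = c m * y.
    elim: m => [|m IH]; first by rewrite mulr0 mul0r.
    rewrite /c iterS -scalerAl -scalerAr mulrDr mulrDl !mulrA -/(c m).
    by rewrite IH -!mulrA IH xy.
  apply: nm_small => e e0.
  have K0 : 0 < 2 * nm y + 1 by have := nm_ge0 y; lra.
  have [M lM] := cl _ (divr_gt0 e0 K0).
  have := lM M (leqnn _); rewrite ltr_pdivlMr //.
  have -> : l * y - y * l = (l - c M) * y - y * (l - c M).
    by rewrite mulrBr mulrBl yc opprB addrA subrK.
  have := nmD ((l - c M) * y) (- (y * (l - c M))); rewrite nmN.
  have := nmM y (l - c M); have := nmM (l - c M) y; have := nm_ge0 (l - c M).
  rewrite (nmB (c M)); lra.
exists (1 - l); split; first by rewrite starB star1 sl.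
  by move=> y /yl ly; rewrite mulrBr mulrBl mulr1 mul1r ly.
have: l + l = x + l * l by rewrite -{1 2}fl -scalerDr scale_half_double.
move/eqP; rewrite -subr_eq => /eqP <-; rewrite mulrBr mulr1 mulrBl mul1r.
by rewrite -[LHS]addrA -opprD addrA.
Qed.

(* a + i b is unitary. *)
Lemma circle_bound a b : star a = a -> star b = b -> a * b = b * a ->
  a * a + b * b = 1 -> nm a <= 1.
Proof.
move=> sa sb ab ab1.
pose u := a + 'i%R *: b; pose v := a - 'i%R *: b.
have uv : star u = v by rewrite starD starZ conjCi sa sb scaleNr.
have vu : star v = u by rewrite -uv starK.
have ii : ('i%R * 'i%R : R[i]) = -1 by rewrite -expr2 sqrCi.
have u1 : star u * u = 1.
  rewrite uv mulrDr mulrBl mulrBl -!scalerAl -!scalerAr scalerA ii scaleN1r.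
  by rewrite opprK -ab addrA subrK.
have v1 : star v * v = 1.
  rewrite vu mulrBr mulrDl mulrDl -!scalerAl -!scalerAr scalerA ii scaleN1r.
  by rewrite ab opprD opprK addrA addrK.
have -> : a = (2^-1 : R[i]) *: (u + v).
  by rewrite addrACA subrr addr0 scale_half_double.
rewrite nm_half; have := nmD u v; rewrite (nm_isometry u1) (nm_isometry v1); lra.
Qed.

(* 1 - l (1 + t) and 1 - l (1 - t) are squares e^2, f^2 for l < 1, and
   e^2 + f^2 = 2 (1 - l) is arbitrarily small. *)
Lemma one_extremal t : star t = t -> nm (1 + t) <= 1 -> nm (1 - t) <= 1 -> t = 0.
Proof.
move=> st tD tB; apply: nm_small => e e0.
have key (l d : R) : 0 <= l -> l < 1 -> d ^+ 2 = (1 - l) + (1 - l) -> 0 < d ->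
    nm (1 - l%:C *: (1 + t)) <= d ^+ 2.
  move=> l0 l1 dd d0.
  have sa x : star x = x -> star (l%:C *: x) = l%:C *: x.
    by move=> sx; rewrite starZ sx conj_Creal // ger0_real // lecR.
  have lt1 x : nm x <= 1 -> nm (l%:C *: x) < 1.
    by move=> nx; rewrite nmZ nm_real //; have := nm_ge0 x; nra.
  have sD : star (1 + t) = 1 + t by rewrite starD star1 st.
  have sB : star (1 - t) = 1 - t by rewrite starB star1 st.
  have [g [sg gC gg]] := sqrt_one_sub (sa _ sD) (lt1 _ tD).
  have [h [sh hC hh]] := sqrt_one_sub (sa _ sB) (lt1 _ tB).
  have tt : l%:C *: (1 + t) * (l%:C *: (1 - t)) = l%:C *: (1 - t) * (l%:C *: (1 + t)).
    rewrite -!scalerAl -!scalerAr; congr (_ *: (_ *: _)).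
    by rewrite mulrBr mulr1 mulrDl mul1r mulrBl mul1r mulrDr mulr1.
  have gh : g * h = h * g by rewrite gC //; symmetry; apply: hC; rewrite -tt.
  have ggh : g * g + h * h = (d ^+ 2)%:C%:A.
    rewrite gg hh dd addrACA -opprD -scalerDr addrACA subrr addr0 scalerDr.
    by rewrite opprD addrACA rmorphD rmorphB rmorph1 /= scalerDl scalerBl scale1r.
  have d2 : (d^-1)%:C * (d^-1)%:C * (d ^+ 2)%:C = 1 :> R[i].
    rewrite -!rmorphM /= (_ : d^-1 * d^-1 * d ^+ 2 = 1) //.
    by rewrite expr2 -mulrA mulKf ?mulVf ?gt_eqF.
  have di : 0 <= d^-1 by rewrite invr_ge0 ltW.
  have dr : (d^-1)%:C^*%R = (d^-1)%:C :> R[i].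
    by rewrite conj_Creal // ger0_real // lecR.
  have := @circle_bound ((d^-1)%:C *: g) ((d^-1)%:C *: h).
  rewrite !starZ sg sh dr -!scalerAl -!scalerAr gh !scalerA -scalerDr ggh scalerA d2 scale1r.
  move=> /(_ erefl erefl erefl erefl); rewrite nmZ nm_real //.
  rewrite ler_pdivrMl // mulr1 => ngd.
  by rewrite -gg; have := nmM g g; have := nm_ge0 g; nra.
(* With l = 1 - s and d^2 = 2 s, [key] yields (1 - s) |t| <= s + 2 s. As s < 1/2, this gives |t| < 6
   s < e. *)
pose s := e / (8 * (1 + e)).
have e8 : 0 < 8 * (1 + e) by lra.
have se : s * (8 * (1 + e)) = e by rewrite /s mulfVK // gt_eqF.
have s0 : 0 < s by apply: divr_gt0.
have s1 : s < 1 / 2 by nra.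
have ss : 0 <= s + s by lra.
have := key (1 - s) (Num.sqrt (s + s)) (ltac:(lra)) (ltac:(lra)).
rewrite sqr_sqrtr // subKr sqrtr_gt0 => /(_ erefl (ltac:(lra))) kl.
have tE : (1 - s)%:C *: t = s%:C%:A - (1 - (1 - s)%:C *: (1 + t)).
  have -> : s%:C%:A = 1 - (1 - s)%:C%:A :> A by rewrite rmorphB /= scalerBl scale1r subKr.
  by rewrite scalerDr opprB [RHS]addrC subrKA addrAC subrr add0r.
have := nmD (s%:C%:A : A) (- (1 - (1 - s)%:C *: (1 + t))).
rewrite -tE nmN !nmZ nm1 mulr1 (nm_real (ltW s0)) nm_real; last by lra.
have := nm_ge0 t; nra.
Qed.

(* For a self-adjoint of norm at most 1/2, f preserves a^2 + b^2 = 1 with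
   b = sqrt (1 - a^2), so circle_bound applies to f a: no spectral radius. *)
Lemma star_hom_bound (f : A -> A) x :
  (forall (c : R[i]) x y, f (c *: x + y) = c *: f x + f y) ->
  f 1 = 1 -> {morph f : x y / x * y} -> {morph f : x / star x} ->
  nm (f x) <= 2 * nm x.
Proof.
move=> fL f1 fM fs.
have fD y z : f (y + z) = f y + f z by rewrite -[y]scale1r fL !scale1r.
have f0 : f 0 = 0 by apply: (addrI (f 0)); rewrite -fD !addr0.
have fZ c y : f (c *: y) = c *: f y by rewrite -[c *: y]addr0 fL f0 addr0.
have sa_bound a : star a = a -> nm (f a) <= 2 * nm a.
  move=> sa; have [/nm_eq0 ->|n0] := eqVneq (nm a) 0; first by rewrite f0 nm0 mulr0.
  have na : 0 < nm a by rewrite lt_def n0 nm_ge0.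
  have n2 : 0 <= (2 * nm a)^-1 by rewrite invr_ge0; lra.
  pose d := ((2 * nm a)^-1)%:C.
  have sda : star (d *: a) = d *: a by rewrite starZ sa conj_Creal // ger0_real // lecR.
  have nda : nm (d *: a) <= 2^-1.
    by rewrite nmZ nm_real // invfM mulfVK.
  have sdd : star ((d *: a) * (d *: a)) = (d *: a) * (d *: a) by rewrite starM sda.
  have ndd : nm ((d *: a) * (d *: a)) < 1.
    by have := nmM (d *: a) (d *: a); have := nm_ge0 (d *: a); nra.
  have [b [sb bC bb]] := sqrt_one_sub sdd ndd.
  have ab : d *: a * b = b * (d *: a) by rewrite bC // mulrA.
  have ab1 : d *: a * (d *: a) + b * b = 1 by rewrite bb addrC subrK.
  have := @circle_bound (f (d *: a)) (f b).
  rewrite -!fs sda sb -!fM ab -fD ab1 f1 => /(_ erefl erefl erefl erefl).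
  by rewrite fZ nmZ nm_real // ler_pdivrMl ?mulr1 //; lra.
(* By the C*-identity the self-adjoint case gives |f x|^2 <= 2 |x|^2, which is stronger than the
   claim. *)
have := sa_bound (star x * x); rewrite starM starK fM fs !nm_cstar => /(_ erefl).
by have := nm_ge0 x; have := nm_ge0 (f x); nra.
Qed.
End Contraction.

(** * Minimal projections *)

Section MinimalProjections.
Context {R : realType} {A : cstarAlgType R}.
Implicit Types x y z : A.

Definition in_span d (v : 'I_d -> A) x :=
  exists c : 'I_d -> R[i], x = \sum_i c i *: v i.

Lemma linear_dependence d (v : 'I_d -> A) m (x : 'I_m -> A) :
  (forall i, in_span v (x i)) -> (d < m)%N ->
  exists2 u : 'I_m -> R[i], (exists i, u i != 0) & \sum_i u i *: x i = 0.
Proof.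
move=> /choice[c xc] dm.
pose C : 'M[R[i]]_(m, d) := \matrix_(i, j) c i j.
have : kermx C != 0.
  by rewrite -mxrank_eq0 mxrank_ker subn_eq0 -ltnNge (leq_ltn_trans (rank_leq_col C)).
case/rowV0Pn => w /sub_kermxP wC w0.
exists (w 0); first by case/rV0Pn: w0 => i wi; exists i.
under eq_bigr => i _ do rewrite xc scaler_sumr.
rewrite exchange_big big1 // => j _.
under eq_bigr => i _ do rewrite scalerA.
rewrite -scaler_suml; have /matrixP/(_ 0 j) := wC; rewrite !mxE => wCj.
rewrite (_ : \sum_i _ = 0) ?scale0r // -[RHS]wCj.
by apply: eq_bigr => i _; rewrite mxE.
Qed.

Definition unital_star_algebra (B : A -> Prop) :=
  [/\ B 1, forall (c : R[i]) x y, B x -> B y -> B (c *: x + y),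
      forall x y, B x -> B y -> B (x * y) & forall x, B x -> B (star x)].

Definition projection x := star x = x /\ x * x = x.

Section StarAlgebra.
Variable B : A -> Prop.
Hypothesis B_alg : unital_star_algebra B.

Lemma star_algebra0 : B 0.
Proof. by case: B_alg => B1 BL _ _; have := BL (-1) 1 1 B1 B1; rewrite scaleN1r addNr. Qed.

Lemma star_algebraZ (c : R[i]) x : B x -> B (c *: x).
Proof. by case: B_alg => _ BL _ _ Bx; rewrite -[_ *: _]addr0; apply: BL Bx star_algebra0. Qed.

Lemma star_algebraD x y : B x -> B y -> B (x + y).
Proof. by case: B_alg => _ BL _ _ Bx By; rewrite -[x]scale1r; apply: BL. Qed.

Lemma star_algebraB x y : B x -> B y -> B (x - y).
Proof. by move=> Bx By; rewrite addrC -scaleN1r; case: B_alg => _ BL _ _; apply: BL. Qed.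

Lemma star_algebra_sum (I : Type) (r : seq I) (F : I -> A) :
  (forall i, B (F i)) -> B (\sum_(i <- r) F i).
Proof. by move=> BF; elim/big_rec: _ => [|i x _ Bx]; [apply: star_algebra0|apply: star_algebraD]. Qed.

Lemma projection_sub p q : projection p -> projection q -> p * q = q -> q * p = q ->
  projection (p - q).
Proof.
move=> [sp pp] [sq qq] pq qp; split; first by rewrite starB sp sq.
by rewrite mulrBr !mulrBl pp qq pq qp subrr subr0.
Qed.

Variables (d : nat) (v : 'I_d -> A).
Hypothesis B_span : forall x, B x -> in_span v x.

(** A linear relation among the first [d.+1] powers of [x] is a nonzero polynomial killing [x]. It
    splits over [R[i]], and its leading coefficient can be divided out. Its roots take the place of
    the spectrum. *)
Lemma annihilating_product x : B x ->
  exists cs : seq R[i], \prod_(c <- cs) (x - c%:A) = 0.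
Proof.
move=> Bx; have [B1 _ BM _] := B_alg.
have Bp i : B (x ^+ i) by elim: i => [|i IH]; rewrite ?expr0 // exprS; apply: BM.
have [|u [i ui] u0] := @linear_dependence d v d.+1 (fun i => x ^+ i) _ (leqnn _).
  by move=> i; apply: B_span.
pose f : {poly R[i]} := \sum_(j < d.+1) u j *: 'X^j.
have f0 : f != 0.
  apply/eqP => /(congr1 (fun g : {poly R[i]} => g`_i)); rewrite coef0 coef_sum.
  rewrite (bigD1 i) //= big1 => [|j ji]; rewrite coefZ coefXn.
    by rewrite eqxx mulr1 addr0 => /eqP; rewrite (negPf ui).
  by rewrite eq_sym (_ : _ == _ = false) ?mulr0 //; apply: negPf.
have [cs fE] := closed_field_poly_normal f; exists cs.
have : horner_alg x f = 0.
  rewrite -[RHS]u0 /f linear_sum /=; apply: eq_bigr => j _.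
  by rewrite linearZ /= rmorphXn /= horner_algX mulr_algl.
rewrite fE linearZ /= mulr_algl rmorph_prod => /eqP; rewrite scaler_eq0 lead_coef_eq0 (negPf f0) /=.
move=> /eqP h; rewrite -[RHS]h; apply: eq_bigr => c _.
by rewrite rmorphB /= horner_algX horner_algC.
Qed.

(* If h g = c g with g = prod_(c' in cs) (h - c') p nonzero, then k = g^* g is
   a nonzero element of the corner on which h, hence g, acts by a scalar; so
   k^2 is a multiple of k, and q is a multiple of k. *)
Lemma proper_subprojection p h : projection p -> B p -> B h -> star h = h ->
  p * h = h -> h * p = h -> (forall c : R[i], h <> c *: p) ->
  exists q, [/\ B q, projection q, p * q = q, q * p = q & q != 0 /\ q != p].
Proof.
move=> [sp pp] Bp Bh sh ph hp h_scalar; have [B1 BL BM Bs] := B_alg.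
pose P (cs : seq R[i]) : A := \prod_(c <- cs) (h - c%:A).
have p0 : p <> 0 by move=> p0; apply: (h_scalar 0); rewrite -hp p0 mulr0 scaler0.
(* Factors are removed from the annihilating product until it no longer kills [p]; the last one
   removed provides the eigenvalue [c]. *)
have [c [cs [g0 cg]]] : exists c cs, P cs * p != 0 /\ (h - c%:A) * (P cs * p) = 0.
  have [cs] := annihilating_product Bh; rewrite -/(P cs) => P0.
  have {P0} : P cs * p = 0 by rewrite P0 mul0r.
  elim: cs => [|c cs IH]; first by rewrite /P big_nil mul1r.
  rewrite {1}/P big_cons -/(P cs) -mulrA => Pc.
  by have [/IH//|g0] := eqVneq (P cs * p) 0; exists c, cs.
have Ph : h * P cs = P cs * h.
  by apply: commr_prod => c' _; apply: commrB => //; rewrite /GRing.comm mulr_algl mulr_algr.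
have Pp : p * P cs = P cs * p.
  apply: commr_prod => c' _; apply: commrB; first by rewrite /GRing.comm ph hp.
  by rewrite /GRing.comm mulr_algl mulr_algr.
have BP : B (P cs).
  rewrite /P; elim/big_rec: _ => // c' x _ Bx; apply: BM => //.
  by apply: star_algebraB => //; apply: star_algebraZ.
set g := P cs * p in g0 cg.
have Bg : B g by apply: BM.
have gp : g * p = g by rewrite /g -mulrA pp.
have pg : p * g = g by rewrite /g mulrA Pp -mulrA pp.
have gh : g * h = c *: g.
  move/eqP: cg; rewrite mulrBl mulr_algl subr_eq0 => /eqP <-.
  by rewrite /g -mulrA ph [RHS]mulrA Ph -mulrA hp.
pose k := star g * g.
have sk : star k = k by rewrite starM starK.
have k_neq0 x : x != 0 -> star x * x != 0.
  apply: contraNneq => xx; apply/eqP/nm_eq0/eqP.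
  by rewrite -sqrf_eq0 -nm_cstar xx nm0.
have k0 : k != 0 by apply: k_neq0.
have pk : p * k = k by rewrite mulrA -{1}sp -starM gp.
have kp : k * p = k by rewrite -mulrA gp.
have kh : k * h = c *: k by rewrite -mulrA gh -scalerAr.
have hk : h * k = c^*%R *: k by rewrite -sh -{1}sk -starM kh starZ sk.
have Pk : P cs * k = \prod_(c' <- cs) (c^*%R - c') *: k.
  rewrite /P; elim: (cs) => [|c' cs' IH]; first by rewrite !big_nil mul1r scale1r.
  rewrite !big_cons -mulrA IH -scalerAr mulrBl hk mulr_algl -scalerBl scalerA.
  by rewrite mulrC.
have kP : k * P cs = \prod_(c' <- cs) (c - c') *: k.
  rewrite /P; elim: (cs) => [|c' cs' IH]; first by rewrite !big_nil mulr1 scale1r.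
  by rewrite !big_cons mulrA mulrBr kh mulr_algr -scalerBl -scalerAl IH scalerA.
(* Multiplication of [k] by [h] gives [c] on the right and its conjugate on the left, so the scalar
   combines the values of the product at both. *)
have [l kk] : exists l : R[i], k * k = l *: k.
  exists (\prod_(c' <- cs) (c^*%R - c') * (\prod_(c' <- cs) (c - c'))^*%R).
  rewrite -{1}/(star g * g) -mulrA -/k /g -[P cs * p * k]mulrA pk Pk -scalerAr -scalerA.
  congr (_ *: _); rewrite -{1}sk -starM /g mulrA kP -scalerAl kp starZ sk //.
have l0 : l != 0.
  by apply: contraNneq (k_neq0 _ k0) => l0; rewrite sk kk l0 scale0r.
have lr : l^*%R = l.
  apply/eqP; rewrite -subr_eq0; have : (l^*%R - l) *: k == 0.
    by rewrite scalerBl -kk -{1}sk -starZ -kk starM sk subrr.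
  by rewrite scaler_eq0 (negPf k0) orbF.
exists (l^-1 *: k); split.
- by apply: star_algebraZ; apply: BM => //; apply: Bs.
- split; first by rewrite starZ sk fmorphV /= lr.
  by rewrite -scalerAl -scalerAr kk !scalerA -mulrA mulVf ?mulr1.
- by rewrite -scalerAr pk.
- by rewrite -scalerAl kp.
split; first by rewrite scaler_eq0 invr_eq0 negb_or l0.
apply/eqP => kE; apply: (h_scalar c^*%R).
by rewrite -{1}hp -kE -scalerAr hk !scalerA mulrC.
Qed.

Definition complete_family r (p : 'I_r -> A) :=
  [/\ forall i, B (p i), forall i, projection (p i), forall i, p i != 0,
      forall i j, i != j -> p i * p j = 0 & \sum_i p i = 1].

Lemma complete_family_size r p : @complete_family r p -> (r <= d)%N.
Proof.
move=> [Bp pP p0 pO _]; rewrite leqNgt; apply/negP => dr.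
have [i|u [i ui] u0] := @linear_dependence d v r p _ dr; first exact: B_span (Bp i).
have : u i *: p i = 0.
  rewrite -[RHS](mulr0 (p i)) -u0 mulr_sumr (bigD1 i) //= big1 => [|j ji].
    by rewrite -scalerAr (pP i).2 addr0.
  by rewrite -scalerAr pO ?scaler0 // eq_sym.
by move/eqP; rewrite scaler_eq0 (negPf ui) (negPf (p0 i)).
Qed.

Lemma complete_family_split r p i q : @complete_family r p -> B q -> projection q ->
  p i * q = q -> q * p i = q -> q != 0 -> q != p i ->
  exists p', @complete_family r.+1 p'.
Proof.
move=> [Bp pP p0 pO p1] Bq qP pq qp q0 qpi.
pose p2 j := if j == i then q else p j.
(* [ord0] receives [p i - q]; the old indices are shifted by one, with [q] in the place of [p i]. *)
exists (fun j => if unlift ord0 j is Some k then p2 k else p i - q).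
have qO j : j != i -> q * p j = 0 /\ p j * q = 0.
  move=> ji; split; first by rewrite -qp -mulrA pO ?mulr0 // eq_sym.
  by rewrite -pq mulrA pO ?mul0r.
have sO j : j != i -> (p i - q) * p j = 0 /\ p j * (p i - q) = 0.
  move=> ji; have [qp0 pq0] := qO j ji.
  by rewrite mulrBl mulrBr qp0 pq0 !pO ?subr0 // eq_sym.
split.
- move=> j; case: unliftP => [k _|_]; last exact: star_algebraB.
  by rewrite /p2; case: eqP.
- move=> j; case: unliftP => [k _|_]; last exact: projection_sub.
  by rewrite /p2; case: eqP.
- move=> j; case: unliftP => [k _|_]; last by rewrite subr_eq0 eq_sym.
  by rewrite /p2; case: (k == i).
- move=> j k; case: unliftP => [j' ->|->]; case: unliftP => [k' ->|->] //.
  + rewrite (inj_eq (@lift_inj _ _)) /p2.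
    case: (eqVneq j' i) => [->|/qO[_ pq0]]; case: (eqVneq k' i) => [_|/qO[qp0 _]] //.
    by apply: pO.
  + by move=> _; rewrite /p2; case: (eqVneq j' i) => [_|/sO[] //]; rewrite mulrBr qp qP.2 subrr.
  + by move=> _; rewrite /p2; case: (eqVneq k' i) => [_|/sO[] //]; rewrite mulrBl pq qP.2 subrr.
- rewrite big_ord_recl unlift_none (eq_bigr p2) => [|j _]; last by rewrite liftK.
  rewrite -p1 (bigD1 i) //= /p2 eqxx addrA subrK [RHS](bigD1 i) //=.
  by congr (_ + _); apply: eq_bigr => j /negPf ->.
Qed.

(** A complete family of maximal size exists by [complete_family_size]. In such a family a
    self-adjoint corner element that is not scalar would give a proper subprojection and split the
    family once more. Minimality is recorded as scalar corners, the form in which it is used. *)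
Lemma minimal_projections : exists r (p : 'I_r -> A), complete_family p /\
  forall i x, B x -> exists c : R[i], p i * x * p i = c *: p i.
Proof.
have [B1 _ BM Bs] := B_alg.
have family1 : exists p, @complete_family 1 p.
  exists (fun=> 1); split => //; rewrite ?big_ord1 ?oner_eq0 //.
    by split; rewrite ?star1 ?mulr1.
  by move=> i j; rewrite !ord1.
pose Q r := `[< exists p, @complete_family r p >].
have Qd r : Q r -> (r <= d)%N by move=> /asboolP[p]; apply: complete_family_size.
have [r /asboolP[p pF] rmax] := ex_maxnP (ex_intro Q 1%N (asboolT family1)) Qd.
have [Bp pP p0 pO p1] := pF.
exists r, p; split => // i x Bx.
have corner_sa h : B h -> star h = h -> exists c : R[i], p i * h * p i = c *: p i.
  move=> Bh sh; have [si ii] := pP i.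
  have [//|nc] := pselect (exists c : R[i], p i * h * p i = c *: p i).
  have [||||c hc|q [Bq qP pq qp [q0 qi]]] :=
    @proper_subprojection (p i) (p i * h * p i) (pP i) (Bp i).
  - by apply: (BM) => //; apply: BM.
  - by rewrite !starM sh si mulrA.
  - by rewrite !mulrA ii.
  - by rewrite -!mulrA ii.
  - by apply: nc; exists c.
  have /asboolT /rmax := complete_family_split pF Bq qP pq qp q0 qi.
  by rewrite ltnn.
have [c1 h1] : exists c : R[i], p i * (x + star x) * p i = c *: p i.
  apply: corner_sa; last by rewrite starD starK addrC.
  by apply: star_algebraD => //; apply: Bs.
have [c2 h2] : exists c : R[i], p i * ('i%R *: (x - star x)) * p i = c *: p i.
  apply: corner_sa; first by apply: star_algebraZ; apply: star_algebraB => //; apply: Bs.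
  by rewrite starZ conjCi starB starK scaleNr -scalerN opprB.
(* x = (h1 - i h2) / 2 with h1 = x + star x and h2 = i (x - star x), both self-adjoint. *)
exists (2^-1 * (c1 - 'i%R * c2)).
have ii : ('i%R * 'i%R : R[i]) = -1 by rewrite -expr2 sqrCi.
rewrite -scalerA scalerBl -h1 -scalerA -h2 -!scalerAr -scalerAl scalerA ii.
rewrite scaleN1r opprK -mulrDl -mulrDr addrACA.
by rewrite subrr addr0 -{1}(scale_half_double x) -scalerAr -scalerAl.
Qed.
End StarAlgebra.
End MinimalProjections.

(** * Words and the gauge grading *)

Section Cuntz.
Context {R : realType} {A : cstarAlgType R}.
Implicit Types p q x y z : A.

Lemma nm_projection p : projection p -> nm p <= 1.
Proof.
by case=> sp pp; have := nm_cstar p; rewrite sp pp; have := nm_ge0 p; nra.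
Qed.

(** Iterated pairs rather than tuples: a sum over words of length [a.+1] splits off the last letter
    by [pair_bigA]. *)
Fixpoint word n a : finType :=
  if a is a'.+1 then (word n a' * 'I_n)%type else unit.

Variables (n : nat) (S : 'I_n -> A).

Fixpoint Sw a : word n a -> A :=
  if a is a'.+1 then fun w => Sw w.1 * S w.2 else fun=> 1.

Hypothesis OnS : cuntz_algebra S.

Lemma S_isom i : star (S i) * S i = 1. Proof. by case: OnS. Qed.

Lemma S_total : \sum_i S i * star (S i) = 1. Proof. by case: OnS. Qed.

(* For j != i let t = S_i^* S_j S_j^* S_i. The sum of these over j != i is 0,
   and |1 - t| <= 1 for each, so |n + t|, |n - t| <= n, whence t = 0. *)
Lemma S_orthogonal i j : i != j -> star (S i) * S j = 0.
Proof.
move=> ij.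
pose t k := star (S i) * S k * (star (S k) * S i).
have tE k : t k = star (star (S k) * S i) * (star (S k) * S i).
  by rewrite /t starM starK.
have t_sum : t j + \sum_(k | (k != i) && (k != j)) t k = 0.
  have ti : t i = 1 by rewrite /t S_isom mulr1.
  have : \sum_k t k = 1.
    rewrite -[RHS](S_isom i) -[X in _ = X * _]mulr1 -S_total mulr_sumr mulr_suml.
    by apply: eq_bigr => k _; rewrite /t !mulrA.
  rewrite (bigD1 i) //= ti (bigD1 j) 1?eq_sym //= => /eqP.
  by rewrite -subr_eq0 addrAC subrr add0r => /eqP.
have nS k : nm (S k) = 1 := nm_isometry (S_isom k).
have t1 k : nm (1 - t k) <= 1.
  have -> : 1 - t k = star (S i) * (1 - S k * star (S k)) * S i.
    by rewrite mulrBr mulrBl mulr1 S_isom /t !mulrA.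
  apply: le_trans (nmM _ _) _; rewrite nS mulr1.
  apply: le_trans (nmM _ _) _; rewrite nm_star nS mul1r.
  apply: nm_projection; apply: projection_sub.
  - by split; rewrite ?star1 ?mulr1.
  - by split; rewrite ?starM ?starK // !mulrA -(mulrA (S k)) S_isom mulr1.
  - by rewrite mul1r.
  - by rewrite mulr1.
(* [N] counts the indices other than [i] and [j]. By [t_sum], M + t_j = 1 + sum of the (1 - t_k)
   over them, while M - t_j = N + (1 - t_j); both have norm at most N + 1. *)
pose N := #|[pred k | (k != i) && (k != j)]|.
pose M : R[i] := (N.+1)%:R.
have M0 : M != 0 by rewrite pnatr_eq0.
have nMV : nm M^-1 = (N.+1%:R)^-1 by rewrite nm_scalarV nm_nat.
have scaled x : nm (M%:A + x) <= N.+1%:R -> nm (1 + M^-1 *: x) <= 1.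
  move=> h; have -> : 1 + M^-1 *: x = M^-1 *: (M%:A + x).
    by rewrite scalerDr scalerA mulVf // scale1r.
  by rewrite nmZ nMV mulrC ler_pdivrMr ?ltr0Sn // mul1r.
have tj0 : M^-1 *: t j = 0.
  apply: one_extremal.
  - by rewrite starZ fmorphV rmorph_nat tE starM starK.
  - apply: scaled; have -> : M%:A + t j = 1 + \sum_(k | (k != i) && (k != j)) (1 - t k).
      rewrite sumrB sumr_const -/N /M scaler_nat mulrS -addrA; congr (_ + (_ + _)).
      by apply/eqP; rewrite -addr_eq0 t_sum.
    apply: le_trans (nmD _ _) _; rewrite nm1 -natr1 addrC lerD2r.
    apply: le_trans (nm_sum _ _ _) _; apply: le_trans (ler_sum _ (fun k _ => t1 k)) _.
    by rewrite sumr_const.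
  - rewrite -scalerN; apply: scaled; rewrite /M -natr1 scalerDl scale1r -addrA.
    apply: le_trans (nmD _ _) _; rewrite nmZ nm_nat nm1 mulr1 -natr1 lerD2l.
    exact: t1.
have : t j = 0 by rewrite -[t j](scalerKV M0) tj0 scaler0.
rewrite tE => tj; have /nm_eq0 : nm (star (S j) * S i) = 0.
  by apply/eqP; rewrite -sqrf_eq0 -nm_cstar tj nm0.
by move/(congr1 star); rewrite starM starK star0.
Qed.

Lemma S_kronecker i j : star (S i) * S j = (i == j)%:R.
Proof. by have [->|/S_orthogonal] := eqVneq i j; [apply: S_isom|]. Qed.

Lemma Sw_kronecker a (v w : word n a) : star (Sw v) * Sw w = (v == w)%:R.
Proof.
elim: a v w => [|a IH]; first by case; case; rewrite /= star1 mulr1.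
case=> v i [w j]; rewrite /= starM -!mulrA [star (Sw v) * _]mulrA IH.
rewrite xpair_eqE; case: eqP => _; last by rewrite mul0r mulr0.
by rewrite mul1r S_kronecker.
Qed.

Lemma Sw_total a : \sum_w @Sw a w * star (Sw w) = 1.
Proof.
elim: a => [|a IH]; first by rewrite (big_pred1 tt) => [|[]] //=; rewrite star1 mulr1.
rewrite -(pair_bigA _ (fun v i => @Sw a.+1 (v, i) * star (@Sw a.+1 (v, i)))) -[RHS]IH.
apply: eq_bigr => v _ /=; rewrite -[X in _ = X * _]mulr1 -S_total mulr_sumr mulr_suml.
by apply: eq_bigr => i _; rewrite starM !mulrA.
Qed.

(* The linear span of the S_v S_w^* with v of length a and w of length b,
   described by matrix coefficients (see words_expansion). *)
Definition words a b x := forall (v : word n a) (w : word n b),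
  exists c : R[i], star (Sw v) * x * Sw w = c%:A.

Lemma words_linear a b (c : R[i]) x y :
  words a b x -> words a b y -> words a b (c *: x + y).
Proof.
move=> xW yW v w; have [r xr] := xW v w; have [s ys] := yW v w.
exists (c * r + s); rewrite mulrDr mulrDl -scalerAr -scalerAl xr ys.
by rewrite scalerA scalerDl.
Qed.

Lemma words0 a b : words a b 0.
Proof. by move=> v w; exists 0; rewrite mulr0 mul0r scale0r. Qed.

Lemma words_star a b x : words a b x -> words b a (star x).
Proof.
move=> xW v w; have [c xc] := xW w v; exists c^*%R.
by rewrite -[RHS]mulr1 -scalerAl mul1r -[X in _ *: X]star1 -starZ -xc !starM starK mulrA.
Qed.

(** Inserting the partition of unity by words between two factors turns a product into a product of
    coefficient matrices. *)
Lemma word_mid a x y : x * y = \sum_(w : word n a) x * Sw w * (star (Sw w) * y).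
Proof.
rewrite -[x in LHS]mulr1 -(Sw_total a) mulr_sumr mulr_suml.
by apply: eq_bigr => w _; rewrite !mulrA.
Qed.

Lemma words_mul a b c x y : words a b x -> words b c y -> words a c (x * y).
Proof.
move=> xW yW v w.
have [r rE] := choice (fun u => xW v u); have [s sE] := choice (fun u => yW u w).
exists (\sum_u r u * s u); rewrite mulrA -mulrA (word_mid b) scaler_suml.
apply: eq_bigr => u _; rewrite rE [star _ * _]mulrA sE.
by rewrite -scalerAl mul1r scalerA.
Qed.

(** S_v S_w^* is the sum over [i] of S_(vi) S_(wi)^*, whence the Kronecker factor in the new
    coefficients. Raising brings two elements of equal degree to common word lengths. *)
Lemma words_raise a b x : words a b x -> words a.+1 b.+1 x.
Proof.
move=> xW [v i] [w j]; have [c xc] := xW v w; exists (c * (i == j)%:R).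
rewrite /= starM -!mulrA [x * _]mulrA [star (Sw v) * _]mulrA [star (Sw v) * _]mulrA xc.
by rewrite -scalerAl mul1r -scalerAr S_kronecker -scalerA scaler_nat.
Qed.

Lemma words_raise_by j a b x : words a b x -> words (j + a) (j + b) x.
Proof. by move=> xW; elim: j => //= j; apply: words_raise. Qed.

Lemma words1 : words 0 0 1.
Proof. by move=> v w; exists 1; rewrite /= star1 !mulr1 scale1r. Qed.

Lemma words_S i : words 1 0 (S i).
Proof.
move=> [v j] w; exists (j == i)%:R; rewrite /= mul1r mulr1 S_kronecker.
by rewrite scaler_nat.
Qed.

Lemma words_expansion a b x : words a b x -> exists c : word n a -> word n b -> R[i],
  x = \sum_v \sum_w c v w *: (Sw v * star (Sw w)).
Proof.
move=> xW; pose c v w := sval (cid (xW v w)); exists c.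
have xc v w : star (Sw v) * x * Sw w = (c v w)%:A := svalP (cid (xW v w)).
rewrite -[LHS]mul1r (word_mid a); apply: eq_bigr => v _; rewrite mul1r.
rewrite -[star _ * x]mulr1 (word_mid b (star _ * x)) mulr_sumr; apply: eq_bigr => w _.
by rewrite xc mulr1 -scalerAl mul1r -scalerAr.
Qed.
End Cuntz.

(** * Operations on norm closures *)

Section Approximation.
Context {R : realType} {A : cstarAlgType R}.
Implicit Types (x y z : A) (B C : A -> Prop).

Lemma approached_self B x : B x -> approached B x.
Proof. by move=> Bx e e0; exists x; rewrite ?subrr ?nm0. Qed.

(** The same approximants serve for both orders of the product, as the commutation rule of the trace
    compares [x * y] with [y * x]. *)
Lemma approached_mul_both B C x y : approached B x -> approached C y ->
  forall e : R, 0 < e -> exists x' y', [/\ B x', C y', nm (x * y - x' * y') < e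
                                         & nm (y * x - y' * x') < e].
Proof.
move=> Bx Cy e e0.
(* The summand [e] forces d = e / K <= 1 and leaves a strict margin: d (|x| + |y| + 1) = e - d e. *)
set K := nm x + nm y + 1 + e.
have K0 : 0 < K by rewrite /K; have := nm_ge0 x; have := nm_ge0 y; lra.
have d0 := divr_gt0 e0 K0; set d := e / K in d0.
have dK : d * K = e by rewrite mulfVK // gt_eqF.
have [x' Bx' xx] := Bx _ d0; have [y' Cy' yy] := Cy _ d0.
have d1 : d <= 1 by rewrite ler_pdivrMr // mul1r /K; have := nm_ge0 x; have := nm_ge0 y; lra.
have mul_diff (u u' v v' : A) : u * v - u' * v' = u * (v - v') + (u - u') * v'.
  by rewrite mulrBr mulrBl subrKA.
have nx := nm_ge0 x; have ny := nm_ge0 y.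
have nx' : nm x' <= nm x + 1.
  by have := nm_trans x' x 0; rewrite !subr0 (nmB x'); lra.
have ny' : nm y' <= nm y + 1.
  by have := nm_trans y' y 0; rewrite !subr0 (nmB y'); lra.
have p1 := mulr_ge0 nx (ltW d0); have p2 := mulr_ge0 ny (ltW d0).
have KE : d * nm x + d * nm y + d < e by move: dK; rewrite /K; have := mulr_gt0 d0 e0; lra.
exists x', y'; split => //; rewrite mul_diff; apply: le_lt_trans (nmD _ _) _.
  have := nmM x (y - y'); have := nmM (x - x') y'.
  have := ler_wpM2l nx (ltW yy); have := ler_pM (nm_ge0 _) (nm_ge0 _) (ltW xx) ny'; lra.
have := nmM y (x - x'); have := nmM (y - y') x'.
have := ler_wpM2l ny (ltW xx); have := ler_pM (nm_ge0 _) (nm_ge0 _) (ltW yy) nx'; lra.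
Qed.

Lemma approached_linear B C x (f : A -> A) (K : R) : 0 <= K ->
  (forall y z, nm (f y - f z) <= K * nm (y - z)) -> (forall y, B y -> C (f y)) ->
  approached B x -> approached C (f x).
Proof.
move=> K0 fK BC Bx e e0; have K1 : 0 < K + 1 by lra.
have [y By xy] := Bx _ (divr_gt0 e0 K1); exists (f y); first exact: BC.
apply: le_lt_trans (fK _ _) _; move: xy; rewrite ltr_pdivlMr //.
by have := nm_ge0 (x - y); lra.
Qed.

Lemma approached_star B C x : (forall y, B y -> C (star y)) -> approached B x -> approached C (star x).
Proof. by apply: (approached_linear (f := @star R A) ler01) => y z; rewrite -starB nm_star mul1r. Qed.

Lemma approached_scale B C (c : R[i]) x : (forall y, B y -> C (c *: y)) ->
  approached B x -> approached C (c *: x).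
Proof.
by apply: (approached_linear (f := *:%R c) (nm_ge0 c)) => y z; rewrite -scalerBr nmZ.
Qed.

Lemma approached_mul B C D x y : (forall x' y', B x' -> C y' -> D (x' * y')) ->
  approached B x -> approached C y -> approached D (x * y).
Proof.
move=> BCD Bx Cy e e0; have [x' [y' [Bx' Cy' xy _]]] := approached_mul_both Bx Cy e0.
by exists (x' * y') => //; apply: BCD.
Qed.

Lemma approached_add B C D x y : (forall x' y', B x' -> C y' -> D (x' + y')) ->
  approached B x -> approached C y -> approached D (x + y).
Proof.
move=> BCD Bx Cy e e0; have e2 : 0 < e / 2 by lra.
have [x' Bx' xx] := Bx _ e2; have [y' Cy' yy] := Cy _ e2.
exists (x' + y'); first exact: BCD.
by rewrite opprD addrACA; apply: le_lt_trans (nmD _ _) _; lra.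
Qed.
End Approximation.

(** * Homogeneous elements and density of polynomials *)

Section Grading.
Context {R : realType} {A : cstarAlgType R} (n : nat) (S : 'I_n -> A).
Hypothesis OnS : cuntz_algebra S.
Implicit Types (x y z : A) (k l : int).

(** Purely algebraic: the two lengths may vary with [x], only their difference is fixed. Elements of
    degree [k] of the complete algebra are those [approached] by these. *)
Definition homogeneous k x := exists a b : nat, k = a%:Z - b%:Z /\ words S a b x.

Lemma homogeneous_linear k (c : R[i]) x y :
  homogeneous k x -> homogeneous k y -> homogeneous k (c *: x + y).
Proof.
move=> [a [b [kab xW]]] [a' [b' [kab' yW]]].
have e : (a' + b = a + b')%N by lia.
exists (a' + a)%N, (a' + b)%N; split; first by lia.
apply: words_linear; first exact: words_raise_by.
by rewrite e [(a' + a)%N]addnC; apply: words_raise_by.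
Qed.

Lemma homogeneous0 k : homogeneous k 0.
Proof.
by case: k => k; [exists k, 0%N|exists 0%N, k.+1]; split;
  rewrite ?subr0 ?sub0r ?NegzE //; apply: words0.
Qed.

Lemma homogeneousZ k (c : R[i]) x : homogeneous k x -> homogeneous k (c *: x).
Proof. by move=> kx; rewrite -[_ *: _]addr0; apply: homogeneous_linear kx (homogeneous0 k). Qed.

Lemma homogeneousD k x y : homogeneous k x -> homogeneous k y -> homogeneous k (x + y).
Proof. by move=> kx ky; rewrite -[x]scale1r; apply: homogeneous_linear. Qed.

Lemma homogeneous_star k x : homogeneous k x -> homogeneous (- k) (star x).
Proof.
move=> [a [b [-> xW]]]; exists b, a; split; first by rewrite opprB.
exact: words_star.
Qed.

Lemma homogeneous_mul k l x y :
  homogeneous k x -> homogeneous l y -> homogeneous (k + l) (x * y).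
Proof.
move=> [a [b [-> xW]]] [c [d [-> yW]]].
exists (c + a)%N, (b + d)%N; split; first by lia.
apply: (words_mul OnS (b := (c + b)%N)); first exact: words_raise_by.
by rewrite [(c + b)%N]addnC; apply: words_raise_by.
Qed.

(** The bound [L] on the degrees is kept because averages over roots of unity separate only degrees
    that are close compared with the number of roots. A degree may occur in several summands. *)
Inductive graded_sum (L : nat) : A -> Prop :=
| GradedSum0 : graded_sum L 0
| GradedSumD k x y : (`|k| <= L)%N -> homogeneous k x -> graded_sum L y ->
    graded_sum L (x + y).

Definition polynomial x := exists L, graded_sum L x.

Lemma graded_sumW L L' x : (L <= L')%N -> graded_sum L x -> graded_sum L' x.
Proof.
move=> LL'; elim=> [|k u v kL ku _ IH]; first exact: GradedSum0.
by apply: GradedSumD ku IH; apply: leq_trans LL'.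
Qed.

Lemma polynomialD x y : polynomial x -> polynomial y -> polynomial (x + y).
Proof.
move=> [L xL] [K yK]; exists (L + K)%N; elim: xL => [|k u v kL ku _ IH].
  by rewrite add0r; apply: graded_sumW yK; apply: leq_addl.
by rewrite -addrA; apply: GradedSumD ku IH; apply: leq_trans (leq_addr _ _).
Qed.

Lemma homogeneous_polynomial k x : homogeneous k x -> polynomial x.
Proof.
move=> kx; exists `|k|%N; rewrite -[x]addr0.
by apply: GradedSumD kx (GradedSum0 _).
Qed.

Lemma polynomial_ind (P : A -> Prop) : P 0 ->
  (forall k x y, homogeneous k x -> P y -> P (x + y)) -> forall x, polynomial x -> P x.
Proof. by move=> P0 PD x [L]; elim=> // k u v _ ku _; apply: PD ku. Qed.

Lemma polynomialZ (c : R[i]) x : polynomial x -> polynomial (c *: x).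
Proof.
elim/polynomial_ind: x / => [|k x y kx IH].
  by rewrite scaler0; exists 0%N; apply: GradedSum0.
rewrite scalerDr; apply: polynomialD => //; apply: (homogeneous_polynomial (k := k)).
exact: homogeneousZ.
Qed.

Lemma polynomial_star x : polynomial x -> polynomial (star x).
Proof.
elim/polynomial_ind: x / => [|k x y kx IH].
  by rewrite star0; exists 0%N; apply: GradedSum0.
rewrite starD; apply: polynomialD => //.
by apply: (homogeneous_polynomial (k := - k)); apply: homogeneous_star.
Qed.

Lemma polynomialM x y : polynomial x -> polynomial y -> polynomial (x * y).
Proof.
move=> xP yP; elim/polynomial_ind: x / xP => [|k x z kx IH].
  by rewrite mul0r; exists 0%N; apply: GradedSum0.
rewrite mulrDl; apply: polynomialD => //.
elim/polynomial_ind: y / yP {IH} => [|l y w ly IH].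
  by rewrite mulr0; exists 0%N; apply: GradedSum0.
rewrite mulrDr; apply: polynomialD => //.
by apply: (homogeneous_polynomial (k := k + l)); apply: homogeneous_mul.
Qed.

(** The elements approached by polynomials form a C*-subalgebra containing the generators, so they
    are everything. *)
Lemma polynomial_dense x : approached polynomial x.
Proof.
have [_ _ full] := OnS; have : [set: A] x by [].
rewrite -full; apply; split; last first.
  move=> _ [i _ <-]; apply: approached_self; apply: (homogeneous_polynomial (k := 1)).
  by exists 1%N, 0%N; split => //; apply: words_S.
split; first exact: approached_closed.
- split; first by apply: approached_self; exists 0%N; apply: GradedSum0.
  by move=> y z; apply: approached_add; apply: polynomialD.
- by move=> c y; apply: approached_scale; apply: polynomialZ.
- by move=> y z; apply: approached_mul; apply: polynomialM.
- by move=> y; apply: approached_star; apply: polynomial_star.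
Qed.
End Grading.

(** * The trace *)

Section Trace.
Context {R : realType} {A : cstarAlgType R} (n : nat) (S : 'I_n -> A).
Hypothesis OnS : cuntz_algebra S.
Hypothesis n_gt0 : (0 < n)%N.
Implicit Types (x y z : A) (k l : int).

Let N : R[i] := n%:R.

Let N0 : N != 0. Proof. by rewrite pnatr_eq0 -lt0n. Qed.

(* The iterates of the average converge, on the dense *-algebra of polynomials,
   to the trace of F_n composed with the conditional expectation onto F_n. *)
Definition average x : A := N^-1 *: \sum_i star (S i) * x * S i.

Lemma averageL (c : R[i]) x y : average (c *: x + y) = c *: average x + average y.
Proof.
rewrite /average scalerA (mulrC c) -scalerA -scalerDr; congr (_ *: _).
by rewrite scaler_sumr -big_split /=; apply: eq_bigr => i _; rewrite mulrDr mulrDl -scalerAr -scalerAl.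
Qed.

Lemma nm_average x : nm (average x) <= nm x.
Proof.
have n0 : 0 < n%:R :> R by rewrite ltr0n.
rewrite nmZ nm_scalarV nm_nat ler_pdivrMl //; apply: le_trans (nm_sum _ _ _) _.
rewrite -[X in _ <= X%:R * _](card_ord n) mulr_natl -sumr_const.
apply: ler_sum => i _; have nS := nm_isometry (S_isom OnS i).
apply: le_trans (nmM _ _) _; rewrite nS mulr1.
by apply: le_trans (nmM _ _) _; rewrite nm_star nS mul1r.
Qed.

Lemma average_scalar (c : R[i]) : average c%:A = c%:A.
Proof.
rewrite /average; under eq_bigr => i _ do rewrite -scalerAr -scalerAl mulr1 (S_isom OnS).
by rewrite sumr_const card_ord -[c%:A *+ n](@scaler_nat R[i]) scalerA mulVf // scale1r.
Qed.

Lemma iter_averageL m (c : R[i]) x y :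
  iter m average (c *: x + y) = c *: iter m average x + iter m average y.
Proof. by elim: m => //= m ->; rewrite averageL. Qed.

Lemma nm_iter_average m x : nm (iter m average x) <= nm x.
Proof. by elim: m => //= m IH; apply: le_trans (nm_average _) IH. Qed.

Lemma iter_average_scalar m (c : R[i]) : iter m average c%:A = c%:A.
Proof. by elim: m => //= m ->; rewrite average_scalar. Qed.

Lemma iter_average a x :
  iter a average x = (N ^+ a)^-1 *: \sum_(w : word n a) star (Sw S w) * x * Sw S w.
Proof.
elim: a => [|a IH].
  by rewrite (big_pred1 tt) => [|[]] //=; rewrite star1 mulr1 mul1r invr1 scale1r.
rewrite iterS IH /average -(pair_bigA _ (fun v i =>
  star (Sw S (v, i) (a := a.+1)) * x * Sw S (v, i) (a := a.+1))) exchange_big /=.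
rewrite exprS invfM -scalerA; congr (_ *: _).
rewrite [RHS]scaler_sumr; apply: eq_bigr => i _; rewrite -scalerAr -scalerAl.
congr (_ *: _); rewrite mulr_sumr mulr_suml; apply: eq_bigr => v _.
by rewrite starM !mulrA.
Qed.

(* null z stands for tau(z) = 0; the trace itself is never constructed. *)
Definition null z := forall e : R, 0 < e -> exists m, nm (iter m average z) < e.

Lemma nullP z e : null z -> 0 < e ->
  exists m, forall j, (m <= j)%N -> nm (iter j average z) < e.
Proof.
move=> z0 /z0[m zm]; exists m => j /subnK <-; apply: le_lt_trans zm.
by rewrite iterD nm_iter_average.
Qed.

Lemma null_linear (c : R[i]) x y : null x -> null y -> null (c *: x + y).
Proof.
move=> xN yN e e0; have c0 : 0 < 2 * (nm c + 1) by have := nm_ge0 c; lra.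
have e2 : 0 < e / 2 by lra.
have [m xm] := nullP xN (divr_gt0 e0 c0); have [m' ym] := nullP yN e2.
exists (m + m')%N; rewrite iter_averageL; apply: le_lt_trans (nmD _ _) _.
have := ym _ (leq_addl m m'); have := xm _ (leq_addr m' m); rewrite nmZ.
rewrite ltr_pdivlMr //; have := nm_ge0 (iter (m + m') average x); lra.
Qed.

Lemma null_approached x : approached null x -> null x.
Proof.
move=> xN e e0; have e2 : 0 < e / 2 by lra.
have [y /(_ _ e2)[m ym] xy] := xN _ e2; exists m.
rewrite -[x](subrK y) -[x - y]scale1r iter_averageL scale1r.
by have := nmD (iter m average (x - y)) (iter m average y);
  have := nm_iter_average m (x - y); lra.
Qed.

(** The double sum of coefficients is symmetric in [x] and [y], but the normalization depends on the
    length over which one averages. This is the origin of the factor n^(-k). *)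
Lemma words_trace a b x y : words S a b x -> words S b a y ->
  exists t : R[i], iter a average (x * y) = ((N ^+ a)^-1 * t)%:A /\
                   iter b average (y * x) = ((N ^+ b)^-1 * t)%:A.
Proof.
move=> xW yW.
pose r v w := sval (cid (xW v w)); pose s w v := sval (cid (yW w v)).
have rE v w : star (Sw S v) * x * Sw S w = (r v w)%:A := svalP (cid (xW v w)).
have sE w v : star (Sw S w) * y * Sw S v = (s w v)%:A := svalP (cid (yW w v)).
exists (\sum_v \sum_w r v w * s w v); split; rewrite iter_average -scalerA.
  congr (_ *: _); rewrite scaler_suml; apply: eq_bigr => v _.
  rewrite mulrA -mulrA (word_mid OnS b) scaler_suml; apply: eq_bigr => w _.
  by rewrite rE [star _ * _]mulrA sE -scalerAl mul1r scalerA.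
congr (_ *: _); rewrite exchange_big scaler_suml; apply: eq_bigr => w _.
rewrite mulrA -mulrA (word_mid OnS a) scaler_suml; apply: eq_bigr => v _.
by rewrite sE [star _ * _]mulrA rE -scalerAl mul1r scalerA mulrC.
Qed.

Lemma homogeneous_kms k x y : homogeneous S k x -> homogeneous S (- k) y ->
  null (x * y - N ^ (- k) *: (y * x)).
Proof.
move=> [a [b [kab xW]]] [c [d [kcd yW]]].
have e : (d + b = a + c)%N by lia.
have xW' : words S (d + a) (d + b) x by apply: words_raise_by.
have yW' : words S (d + b) (d + a) y.
  by rewrite e [(d + a)%N]addnC; apply: words_raise_by.
have [t [tx ty]] := words_trace xW' yW'.
(* [x * y] is scalar after d + a averages and [y * x] after d + b; scalars are fixed, so the total
   number serves for both. *)
move=> eps eps0; exists ((d + a) + (d + b))%N.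
suff -> : iter (d + a + (d + b)) average (x * y - N ^ (- k) *: (y * x)) = 0 by rewrite nm0.
have xM : iter (d + a + (d + b)) average (x * y) = ((N ^+ (d + a))^-1 * t)%:A.
  by rewrite addnC iterD tx iter_average_scalar.
have yM : iter (d + a + (d + b)) average (y * x) = ((N ^+ (d + b))^-1 * t)%:A.
  by rewrite iterD ty iter_average_scalar.
rewrite addrC -scaleNr iter_averageL xM yM scalerA -scalerDl mulNr mulrA.
suff -> : N ^ (- k) * (N ^+ (d + b))^-1 = (N ^+ (d + a))^-1 by rewrite addNr scale0r.
have -> : N ^ (- k) = N ^+ b * (N ^+ a)^-1.
  by rewrite kab opprB expfzDr // -exprnN.
have := expf_neq0 a N0; have := expf_neq0 b N0; have := expf_neq0 d N0.
by rewrite !exprD => d0 b0 a0; field; rewrite d0 b0 a0.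
Qed.

Lemma kms k x y : approached (homogeneous S k) x -> approached (homogeneous S (- k)) y ->
  null (x * y - N ^ (- k) *: (y * x)).
Proof.
move=> xk yk; apply: null_approached => e e0.
have c1 : 0 < 1 + nm (N ^ (- k)) by have := nm_ge0 (N ^ (- k)); lra.
have [x' [y' [x'k y'k xy yx]]] := approached_mul_both xk yk (divr_gt0 e0 c1).
exists (x' * y' - N ^ (- k) *: (y' * x')); first exact: homogeneous_kms.
rewrite opprD addrACA -opprD -scalerBr.
apply: le_lt_trans (nmD _ _) _; rewrite nmN nmZ.
move: xy yx; rewrite !ltr_pdivlMr //; have := nm_ge0 (N ^ (- k)).
have := nm_ge0 (y * x - y' * x'); nra.
Qed.

(** Positivity of the trace: the eventual scalar is n^(-b) times the sum of the squared moduli of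
    the coefficients of [x]. *)
Lemma homogeneous_square k x : homogeneous S k x -> exists m (c : R[i]),
  0 <= c /\ forall j, (m <= j)%N -> iter j average (star x * x) = c%:A.
Proof.
move=> [a [b [_ xW]]]; exists b.
pose r v w := sval (cid (xW v w)).
have rE v w : star (Sw S v) * x * Sw S w = (r v w)%:A := svalP (cid (xW v w)).
exists ((N ^+ b)^-1 * \sum_w \sum_v `|r v w| ^+ 2); split.
  rewrite mulr_ge0 ?invr_ge0 ?exprn_ge0 ?ler0n //.
  by apply: sumr_ge0 => w _; apply: sumr_ge0 => v _; rewrite exprn_ge0.
move=> j /subnK <-; rewrite iterD; have <- := iter_average_scalar (j - b).
congr (iter _ _ _); rewrite iter_average -scalerA; congr (_ *: _).
rewrite scaler_suml; apply: eq_bigr => w _.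
rewrite mulrA -mulrA (word_mid OnS a) scaler_suml; apply: eq_bigr => v _.
rewrite [star _ * (_ * _)]mulrA rE.
have -> : star (Sw S w) * star x * Sw S v = (r v w)^*%R%:A.
  by rewrite -star1 -starZ -rE !starM starK mulrA.
by rewrite -scalerAl mul1r scalerA normCK mulrC.
Qed.

Lemma approached_square B x e : approached B x -> 0 < e ->
  exists2 x' : A, B x' & nm (star x * x - star x' * x') < e.
Proof.
move=> Bx e0; set K := 2 * nm x + 1 + e; have nx := nm_ge0 x.
have K0 : 0 < K by rewrite /K; lra.
have d0 := divr_gt0 e0 K0; set d := e / K in d0.
have dK : d * K = e by rewrite mulfVK // gt_eqF.
have d1 : d <= 1 by rewrite ler_pdivrMr // mul1r /K; lra.
have [x' Bx' xx] := Bx _ d0; exists x' => //.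
have -> : star x * x - star x' * x' = star x * (x - x') + star (x - x') * x'.
  by rewrite starB mulrBr mulrBl subrKA.
have nx' : nm x' <= nm x + 1.
  by have := nm_trans x' x 0; rewrite !subr0 (nmB x'); lra.
have KE : 2 * (d * nm x) + d < e by move: dK; rewrite /K; have := mulr_gt0 d0 e0; lra.
apply: le_lt_trans (nmD _ _) _.
have := nmM (star x) (x - x'); have := nmM (star (x - x')) x'; rewrite !nm_star.
have := ler_wpM2l nx (ltW xx); have := ler_pM (nm_ge0 _) (nm_ge0 _) (ltW xx) nx'; lra.
Qed.

(** Stands for 0 <= tau(y^* y) <= tau(x^* x + y^* y). For algebraic approximants the averages of the
    squares are eventually scalars c, d >= 0, and d <= c + d; four errors of e / 4 add up to [e]. *)
Lemma null_positive k l x y : approached (homogeneous S k) x ->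
  approached (homogeneous S l) y -> null (star x * x + star y * y) -> null (star y * y).
Proof.
move=> xk yl xyN e e0; have e4 : 0 < e / 4 by lra.
have [x' x'k xx] := approached_square xk e4; have [y' y'l yy] := approached_square yl e4.
have [m [c [c0 cE]]] := homogeneous_square x'k.
have [p [d [d0 dE]]] := homogeneous_square y'l.
have [q qE] := nullP xyN e4; exists (m + p + q)%N.
have := qE _ (leq_addl (m + p) q).
have := cE _ (leq_trans (leq_addr p m) (leq_addr q _)).
have := dE _ (leq_trans (leq_addl m p) (leq_addr q _)).
set T := iter _ _ => dT cT sT.
have TD u v : T (u + v) = T u + T v by rewrite /T -[u]scale1r iter_averageL !scale1r.
have nT u v : nm (T u) <= nm (T v) + nm (u - v).
  rewrite -{1}(subrK v u) TD addrC; apply: le_trans (nmD _ _) _.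
  by rewrite lerD2l nm_iter_average.
have cd : nm (d%:A : A) <= nm (T (star x' * x' + star y' * y')).
  rewrite TD cT dT -scalerDl !nmZ nm1 !mulr1 -lecR -!nmE.
  by rewrite !ger0_norm ?addr_ge0 // lerDr.
have := nT (star x' * x' + star y' * y') (star x * x + star y * y).
have := nT (star y * y) (star y' * y'); rewrite dT.
rewrite opprD addrACA; have := nmD (star x' * x' - star x * x) (star y' * y' - star y * y).
by rewrite ![nm (star _ * _ - star x * _)]nmB ![nm (star _ * _ - star y * _)]nmB; lra.
Qed.

(** Averaging fixes scalars and does not increase norms, so the averages of [x] stay within |x - c|
    of [c] and away from 0. *)
Lemma nonnull_scalar (c : R[i]) x : nm (x - c%:A) < nm c -> ~ null x.
Proof.
rewrite -subr_gt0 => xc /(_ _ xc)[m]; apply/negP; rewrite -leNgt.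
have := nm_iter_average m (x - c%:A); rewrite -{1}scaleN1r addrC iter_averageL.
rewrite iter_average_scalar scaleN1r nmB.
have := nmD (c%:A - iter m average x) (iter m average x); rewrite subrK nmZ nm1 mulr1.
by rewrite (addrC (- _)) (nmB (iter _ _ _)); lra.
Qed.
End Trace.

(** * Faithfulness of the trace on projections *)

Section Faithful.
Context {R : realType} {A : cstarAlgType R}.
Implicit Types (p q x y z : A).

Lemma scalar_real (c : R[i]) x : x != 0 -> star (c *: x) = c *: x -> star x = x ->
  c = (complex.Re c)%:C.
Proof.
move=> x0 + sx; rewrite starZ sx => /eqP; rewrite -subr_eq0 -scalerBl scaler_eq0.
rewrite (negPf x0) orbF subr_eq0 -CrealE => cr; rewrite RRe_real //.
Qed.

(* cos = t_i / delta and sin = sqrt (1 - cos^2) on the i-th projection. *)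
Lemma nm_diagonal (B : A -> Prop) r (p : 'I_r -> A) (t : 'I_r -> R) (delta : R) :
  complete_family B p -> 0 < delta -> (forall i, `|t i| <= delta) ->
  nm (\sum_i (t i)%:C *: p i) <= delta.
Proof.
move=> [_ pP _ pO p1] d0 td.
pose D (f : 'I_r -> R) : A := \sum_i (f i)%:C *: p i.
have Dstar f : star (D f) = D f.
  rewrite star_sum; apply: eq_bigr => i _.
  by rewrite starZ (pP i).1 conj_Creal // complex_real.
have DM f g : D f * D g = D (fun i => f i * g i).
  rewrite mulr_suml; apply: eq_bigr => i _.
  rewrite mulr_sumr (bigD1 i) //= big1 ?addr0 => [|j ji].
    by rewrite -scalerAl -scalerAr (pP i).2 scalerA rmorphM.
  by rewrite -scalerAl -scalerAr pO ?scaler0 // eq_sym.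
pose c i := t i / delta; pose s i := Num.sqrt (1 - c i ^+ 2).
have c1 i : 0 <= 1 - c i ^+ 2.
  rewrite subr_ge0 -real_normK ?num_real // expr_le1 // normrM normfV.
  by rewrite (gtr0_norm d0) ler_pdivrMr // mul1r.
have cs : D c * D s = D s * D c.
  by rewrite !DM; congr D; apply/funext => i; rewrite mulrC.
have cs1 : D c * D c + D s * D s = 1.
  rewrite !DM -big_split -p1; apply: eq_bigr => i _ /=.
  rewrite -scalerDl -rmorphD /= -!expr2 sqr_sqrtr // addrC subrK.
  by rewrite scale1r.
have := circle_bound (Dstar c) (Dstar s) cs cs1.
have -> : \sum_i (t i)%:C *: p i = delta%:C *: D c.
  rewrite scaler_sumr; apply: eq_bigr => i _; rewrite scalerA -rmorphM /=.
  by rewrite mulrC mulfVK // gt_eqF.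
by rewrite nmZ (nm_real (ltW d0)) => h; rewrite -[leRHS]mulr1 ler_pM2l.
Qed.

Variables (n : nat) (S : 'I_n -> A).
Hypothesis OnS : cuntz_algebra S.
Hypothesis n_gt0 : (0 < n)%N.

Lemma words_span a b x : words S a b x ->
  in_span (fun i : 'I_#|{: word n a * word n b}| =>
    let vw := enum_val i in Sw S vw.1 * star (Sw S vw.2)) x.
Proof.
move=> /(words_expansion OnS)[c ->].
exists (fun i => let vw := enum_val i in c vw.1 vw.2).
by rewrite pair_bigA /= (reindex _ (onW_bij _ (enum_val_bij _))).
Qed.

Lemma words_algebra m x : words S m m x -> star x = x ->
  unital_star_algebra (fun y => words S m m y /\ y * x = x * y).
Proof.
move=> xW sx; split.
- split; last by rewrite mulr1 mul1r.
  by rewrite -[m]addn0; apply: words_raise_by => //; apply: words1.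
- move=> c y z [yW yx] [zW zx]; split; first exact: words_linear.
  by rewrite mulrDl mulrDr -scalerAl -scalerAr yx zx.
- move=> y z [yW yx] [zW zx]; split; first exact: (words_mul OnS yW zW).
  by rewrite -mulrA zx mulrA yx mulrA.
- move=> y [yW yx]; split; first exact: words_star.
  by rewrite -[x in LHS]sx -starM -yx starM sx.
Qed.

Lemma words_Sw a (w : word n a) : words S a 0 (Sw S w).
Proof.
by move=> v u; exists (v == w)%:R; rewrite /= mulr1 (Sw_kronecker OnS) scaler_nat.
Qed.

(* x in M_(n^m) approximates p. In the algebra of elements of M_(n^m) commuting
   with x, x is diagonalized by minimal projections e_i, and one eigenvalue d_i
   is not small. For z = e_i S_w <> 0, z^* p z is close to the scalar
   d_i z^* z, so it is not null; but p >= p z z^* p / c, with c = z^* z, and the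
   KMS identity would make it null if p were. *)
Lemma null_projection p : projection p -> approached (homogeneous S 0) p ->
  null S p -> p = 0.
Proof.
move=> [sp pp] p_deg0 pN; apply/eqP/negPn/negP => p0.
have np : nm p = 1.
  have n0 : nm p != 0 by apply: contraNneq p0 => /nm_eq0 ->.
  by apply: (mulfI n0); rewrite mulr1 -expr2 -nm_cstar sp pp.
(* As |p| = 1, a self-adjoint [x] within 1/4 of [p] has norm above 1/4; so some eigenvalue of [x]
   exceeds 1/4 in modulus, hence also |p - x|. *)
have [x0 [m [m' [mm x0W]]] px0] := p_deg0 4^-1 (ltac:(lra)).
have {mm} mm : m' = m by lia.
rewrite {}mm in x0W.
pose x : A := (2^-1 : R[i]) *: (x0 + star x0).
have sx : star x = x by rewrite star_half starD starK addrC.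
have xW : words S m m x.
  rewrite /x -[_ *: _]addr0; apply: words_linear; last exact: words0.
  by rewrite -[x0]scale1r; apply: words_linear => //; apply: words_star; rewrite scale1r.
have px : nm (p - x) < 4^-1.
  have -> : p - x = (2^-1 : R[i]) *: ((p - x0) + star (p - x0)).
    by rewrite starB sp addrACA scalerDr scale_half_double -opprD scalerN.
  rewrite nm_half; have := nmD (p - x0) (star (p - x0)); rewrite nm_star; lra.
have B_alg := words_algebra xW sx.
have B_span y : words S m m y /\ y * x = x * y -> _ := fun yB => words_span yB.1.
have [r [e [eF e_corner]]] := minimal_projections B_alg B_span.
have [eB eP e0 eO e1] := eF.
have exe i : e i * x * e i = x * e i.
  by rewrite (eB i).2 -mulrA (eP i).2.
have [d dE] := choice (fun i => e_corner i x (conj xW erefl)).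
have dr i : d i = (complex.Re (d i))%:C.
  apply: (scalar_real (e0 i)); last by case: (eP i).
  by rewrite -dE !starM sx (eP i).1 mulrA.
have xE : x = \sum_i (complex.Re (d i))%:C *: e i.
  by rewrite -[LHS]mulr1 -e1 mulr_sumr; apply: eq_bigr => i _; rewrite -dr -dE exe.
have [i di] : exists i, 4^-1 < nm (d i).
  apply: contrapT => small.
  have : nm x <= 4^-1.
    rewrite xE; apply: (nm_diagonal eF) => [|i]; first lra.
    rewrite leNgt; apply/negP => big; apply: small; exists i.
    by rewrite dr /nm normc_def /= expr0n addr0 sqrtr_sqr.
  have := nmD (p - x) x; rewrite subrK np; lra.
have [si ii] := eP i.
have [w z0] : exists w : word n m, e i * Sw S w != 0.
  apply: contrapT => none; move/eqP: (e0 i); apply.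
  rewrite -[LHS]mulr1 -(Sw_total OnS m) mulr_sumr big1 // => w _.
  have [ew0|ew0] := eqVneq (e i * Sw S w) 0; first by rewrite mulrA ew0 mul0r.
  by case: none; exists w.
pose z := e i * Sw S w.
have ez : e i * z = z by rewrite mulrA ii.
have zW : words S m 0 z by apply: (words_mul OnS (eB i).1); apply: words_Sw.
have [c zz] : exists c : R[i], star z * z = c%:A.
  have [c cE] := (eB i).1 w w; exists c.
  by rewrite starM si -mulrA ez -cE mulrA.
have c0 : c != 0.
  apply: contraNneq z0 => c0; apply/eqP/nm_eq0/eqP.
  by rewrite -sqrf_eq0 -nm_cstar zz c0 scale0r nm0.
have cr : c = (complex.Re c)%:C.
  apply: (scalar_real (x := (1 : A))); rewrite ?oner_neq0 ?star1 //.
  by rewrite -zz starM starK.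
have zxz : star z * x * z = (c * d i)%:A.
  have -> : star z * x * z = star z * (x * e i) * z.
    by rewrite -!mulrA ez.
  by rewrite -exe dE -scalerAr -scalerAl -mulrA ez zz scalerA mulrC.
suff : null S (star z * p * z).
  apply: (nonnull_scalar OnS n_gt0 (c := c * d i)).
  rewrite -zxz -mulrBl -mulrBr; apply: le_lt_trans (nmM _ _) _.
  have nz : nm z ^+ 2 = nm c by rewrite -nm_cstar zz nmZ nm1 mulr1.
  have nc : 0 < nm c by rewrite lt_def nm_ge0 andbT; apply: contraNneq c0 => /nm_eq0 ->.
  have := nmM (star z) (p - x); rewrite nm_star => zpx.
  have := ler_wpM2r (nm_ge0 z) zpx; rewrite nm_scalarM.
  have := nm_ge0 (p - x); nra.
have z_deg : approached (homogeneous S m) z.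
  by apply: approached_self; exists m, 0%N; split; rewrite ?subr0.
have zs_deg : approached (homogeneous S (- m%:Z)) (star z).
  by apply: approached_star z_deg => y; apply: homogeneous_star.
pose q := c^-1 *: (z * star z).
have qP : projection q.
  split; first by rewrite starZ fmorphV /= starM starK conj_Creal // cr complex_real.
  rewrite -scalerAl -scalerAr mulrA -(mulrA z) zz -scalerAr mulr1 -scalerAl.
  by rewrite !scalerA -mulrA mulVf // mulr1.
have qpP : p = star ((1 - q) * p) * ((1 - q) * p) + star (q * p) * (q * p).
  have [_ qq'] : projection (1 - q).
    by apply: projection_sub; rewrite ?mul1r ?mulr1 //; split; rewrite ?star1 ?mulr1.
  rewrite !starM starB star1 sp qP.1 -!mulrA (mulrA (1 - q)) qq' (mulrA q) qP.2.
  by rewrite -mulrDr -mulrDl subrK mul1r pp.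
have deg0M y u : approached (homogeneous S 0) y -> approached (homogeneous S 0) u ->
    approached (homogeneous S 0) (y * u).
  by apply: approached_mul => y' u' y'0 u'0; rewrite -[0]addr0; apply: (homogeneous_mul OnS).
have q_deg : approached (homogeneous S 0) q.
  apply: (approached_scale (B := homogeneous S 0)) => [y|]; first exact: homogeneousZ.
  apply: approached_mul z_deg zs_deg => y u ym um.
  by rewrite -[0](subrr m%:Z); apply: (homogeneous_mul OnS).
have q'_deg : approached (homogeneous S 0) (1 - q).
  apply: (approached_add (B := homogeneous S 0) (C := homogeneous S 0)).
  - by move=> y u; apply: homogeneousD.
  - by apply: approached_self; exists 0%N, 0%N; split => //; apply: words1.
  - by rewrite -scaleN1r; apply: (approached_scale (B := homogeneous S 0)) => // y; apply: homogeneousZ.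
have : null S (star (q * p) * (q * p)).
  by apply: (null_positive OnS n_gt0 (deg0M _ _ q'_deg p_deg0) (deg0M _ _ q_deg p_deg0)); rewrite -qpP.
have -> : star (q * p) * (q * p) = c^-1 *: (p * z * (star z * p)).
  by rewrite starM sp qP.1 !mulrA -(mulrA p) qP.2 /q -scalerAr -scalerAl !mulrA.
have null0 : null S 0.
  by rewrite -(addNr p) -scaleN1r; apply: null_linear.
(* The factor [c] undoes c^-1, and n^m is the factor that [kms] produces for [star z * p], of degree
   -m. As p p = p, the swapped product is [star z * p * z]. *)
move=> /(null_linear OnS n_gt0 (n%:R ^ m%:Z * c))/(_ null0).
rewrite addr0 scalerA mulfK // => pzzp.
have zp_deg : approached (homogeneous S (- m%:Z)) (star z * p).
  by apply: approached_mul zs_deg p_deg0 => y u ym u0; rewrite -[- _]addr0; apply: (homogeneous_mul OnS).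
have pz_deg : approached (homogeneous S (- - m%:Z)) (p * z).
  by apply: approached_mul p_deg0 z_deg => y u y0 um; rewrite opprK -[m%:Z]add0r; apply: (homogeneous_mul OnS).
have /(null_linear OnS n_gt0 1)/(_ pzzp) := kms OnS n_gt0 zp_deg pz_deg.
by rewrite opprK scale1r subrK -mulrA (mulrA p) pp mulrA.
Qed.
End Faithful.

(** * Fourier coefficients *)

Section Tends.
Context {R : realType} {A : cstarAlgType R}.
Implicit Types (x y z : A) (u v : nat -> A).

Lemma tends_eventually u M x : (forall m, (M <= m)%N -> u m = x) -> tends u x.
Proof. by move=> ux e e0; exists M => m /ux ->; rewrite subrr nm0. Qed.

Lemma tends_bounded_linear (f : A -> A) (K : R) u x : 0 <= K ->
  (forall y z, nm (f y - f z) <= K * nm (y - z)) ->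
  tends u x -> tends (fun m => f (u m)) (f x).
Proof.
move=> K0 fK ux e e0; have K1 : 0 < K + 1 by lra.
have [M uM] := ux _ (divr_gt0 e0 K1); exists M => m /uM; rewrite ltr_pdivlMr // => h.
by apply: le_lt_trans (fK _ _) _; have := nm_ge0 (u m - x); lra.
Qed.

Lemma tendsD u v x y : tends u x -> tends v y -> tends (fun m => u m + v m) (x + y).
Proof.
move=> ux vy e e0; have e2 : 0 < e / 2 by lra.
have [M uM] := ux _ e2; have [K vK] := vy _ e2; exists (M + K)%N => m Mm.
have := uM m (leq_trans (leq_addr _ _) Mm); have := vK m (leq_trans (leq_addl _ _) Mm).
rewrite opprD addrACA; have := nmD (u m - x) (v m - y); lra.
Qed.

Lemma tendsZ (c : R[i]) u x : tends u x -> tends (fun m => c *: u m) (c *: x).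
Proof.
apply: (tends_bounded_linear (f := *:%R c) (nm_ge0 c)) => y z.
by rewrite -scalerBr nmZ.
Qed.

Lemma tendsMl a u x : tends u x -> tends (fun m => a * u m) (a * x).
Proof.
apply: (tends_bounded_linear (f := *%R a) (nm_ge0 a)) => y z.
by rewrite -mulrBr nmM.
Qed.

Lemma tendsMr a u x : tends u x -> tends (fun m => u m * a) (x * a).
Proof.
apply: (tends_bounded_linear (f := *%R^~ a) (nm_ge0 a)) => y z.
by rewrite -mulrBl mulrC nmM.
Qed.

Lemma tends_sum (I : Type) (r : seq I) (f : nat -> I -> A) (g : I -> A) :
  (forall i, tends (f^~ i) (g i)) ->
  tends (fun m => \sum_(i <- r) f m i) (\sum_(i <- r) g i).
Proof.
move=> fg; elim: r => [|i r IH].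
  by rewrite big_nil; apply: (tends_eventually (M := 0)) => m _; rewrite big_nil.
rewrite big_cons (_ : (fun m => _) = fun m => f m i + \sum_(j <- r) f m j).
  exact: tendsD.
by apply/funext => m; rewrite big_cons.
Qed.

Lemma tends_bound u x (K : R) : (forall m, nm (u m) <= K) -> tends u x -> nm x <= K.
Proof.
move=> uK ux; rewrite leNgt; apply/negP; rewrite -subr_gt0 => /ux[M /(_ M (leqnn _))].
by have := uK M; have := nm_trans x (u M) 0; rewrite !subr0 (nmB x); lra.
Qed.
End Tends.

(** * Sampling at roots of unity *)

Section RootsOfUnity.
Context {R : realType}.
Implicit Types (k l : int).

(** Powers of 2 make primitivity immediate: a [2 ^ m]-th root of -1 has order dividing [2 ^ m.+1]
    but not [2 ^ m]. *)
Lemma primitive_roots : exists w : nat -> R[i], forall m, (2 ^ m).-primitive_root (w m).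
Proof.
suff /choice[w wP] : forall m, exists z : R[i], (2 ^ m).-primitive_root z by exists w.
case=> [|m].
  by exists 1; rewrite /primitive_root_of_unity expn0 /=; apply/forallP => i; rewrite ord1 /= unity_rootE expr1n eqxx.
pose z : R[i] := (2 ^ m).-root (-1); exists z.
have zm : z ^+ (2 ^ m) = -1 by apply: rootCK; rewrite expn_gt0.
have z1 : z ^+ (2 ^ m.+1) = 1 by rewrite expnSr exprM zm sqrrN expr1n.
have [d zd /(dvdn_pfactor _ _ (isT : prime 2))[j jm dj]] := prim_order_exists (expn_gt0 2 m.+1) z1.
case: (ltngtP j m.+1) jm => // [|jm _]; last by rewrite -jm -dj.
rewrite ltnS => jm _; have : (d %| 2 ^ m)%N by rewrite dj dvdn_exp2l.
by rewrite (prim_order_dvd zd) zm eq_sym -addr_eq0 -mulr2n pnatr_eq0.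
Qed.

Lemma nm_root_of_unity N (z : R[i]) : (0 < N)%N -> z ^+ N = 1 -> `|z| = 1.
Proof.
move=> N0 zN; apply/eqP; rewrite -(@pexpr_eq1 _ _ N) ?normr_ge0 //.
by rewrite -normrX zN normr1.
Qed.

Lemma conj_unimodular (z : R[i]) : `|z| = 1 -> z^*%R = z^-1.
Proof.
move=> z1; have z0 : z != 0 by rewrite -normr_eq0 z1 oner_eq0.
by apply: (mulfI z0); rewrite -normCK z1 expr1n mulfV.
Qed.

Lemma unimodular_exprz (z : R[i]) k : `|z| = 1 -> `|z ^ k| = 1.
Proof.
by move=> z1; case: k => k; rewrite ?NegzE -?exprnN -?exprnP ?normfV normrX z1 expr1n ?invr1.
Qed.

Lemma root_sum N (z : R[i]) k : N.-primitive_root z -> (`|k| < N)%N ->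
  \sum_(j < N) (z ^+ j) ^ k = if k == 0 then N%:R else 0.
Proof.
move=> zN kN; case: eqP => [->|/eqP k0].
  by under eq_bigr => j _ do rewrite expr0z; rewrite sumr_const card_ord.
have z0 : z != 0.
  apply/eqP => z0; have := prim_expr_order zN.
  by rewrite z0 expr0n gtn_eqF ?(prim_order_gt0 zN) // => /eqP; rewrite eq_sym oner_eq0.
have w1 : z ^ k != 1.
  have zk : z ^+ `|k|%N != 1 by rewrite -(prim_order_dvd zN) gtnNdvd ?absz_gt0.
  case: k kN k0 zk => // k _ _; by rewrite -[z ^ _]/(z ^- k.+1) invr_eq1.
have wN : (z ^ k) ^+ N = 1.
  by rewrite exprnP exprzAC -exprnP (prim_expr_order zN) exp1rz.
under eq_bigr => j _ do rewrite exprnP exprzAC -exprnP.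
have := subrX1 (z ^ k) N; rewrite wN subrr => /esym/eqP.
by rewrite mulf_eq0 subr_eq0 (negPf w1) /= => /eqP.
Qed.

(** Parseval for a sum of [K] consecutive powers sampled at [N] points; [K <= N] keeps differences
    of exponents below [N], so distinct powers are orthogonal. *)
Lemma root_norm_sum N (z : R[i]) K : N.-primitive_root z -> (K <= N)%N ->
  \sum_(j < N) nm (\sum_(a < K) (z ^+ j) ^+ a) ^+ 2 = (N * K)%N%:R.
Proof.
move=> zN KN; have N0 := prim_order_gt0 zN.
have zj1 j : `|z ^+ j| = 1 by rewrite normrX (nm_root_of_unity N0 (prim_expr_order zN)) expr1n.
apply: (@complexI R); rewrite rmorph_sum /=.
transitivity (\sum_(a < K) \sum_(b < K) \sum_(j < N) (z ^+ j) ^ (a%:Z - b%:Z)).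
  under [RHS]eq_bigr => a _ do rewrite exchange_big.
  rewrite exchange_big /=; apply: eq_bigr => j _.
  have zj0 : z ^+ j != 0 by rewrite -normr_eq0 zj1 oner_eq0.
  rewrite rmorphXn /= -nmE normCK mulr_suml; apply: eq_bigr => a _.
  rewrite rmorph_sum mulr_sumr; apply: eq_bigr => b _.
  by rewrite rmorphXn /= conj_unimodular // expfzDr // exprVn -exprnN.
rewrite rmorph_nat mulnC natrM mulr_natl -[in RHS](card_ord K) -sumr_const.
apply: eq_bigr => a _; rewrite (bigD1 a) //= subrr (root_sum zN) ?prim_order_gt0 //=.
rewrite [X in _ + X]big1 ?addr0 // => b ba; rewrite (root_sum zN).
  by rewrite subr_eq0 eqz_nat eq_sym val_eqE (negPf ba).
by have := ltn_ord a; have := ltn_ord b; lia.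
Qed.
Definition root_2pow : nat -> R[i] := sval (cid primitive_roots).

Lemma root_2powP m : (2 ^ m).-primitive_root (root_2pow m).
Proof. exact: svalP (cid primitive_roots) m. Qed.

Lemma root_2pow_norm m j : `|root_2pow m ^+ j| = 1.
Proof.
rewrite normrX (nm_root_of_unity _ (prim_expr_order (root_2powP m))) ?expn_gt0 //.
by rewrite expr1n.
Qed.

End RootsOfUnity.

Section Fourier.
Context {R : realType} {A : cstarAlgType R} (n : nat) (S : 'I_n -> A).
Hypothesis OnS : cuntz_algebra S.
Variable gamma : R[i] -> A -> A.
Hypothesis gammaP : gauge_action S gamma.
Implicit Types (x y z : A) (k l : int) (w : R[i]).

Lemma gauge_linear w (c : R[i]) x y : `|w| = 1 ->
  gamma w (c *: x + y) = c *: gamma w x + gamma w y.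
Proof. by case: gammaP => aut _ _ _ /aut[]. Qed.

Lemma gaugeM w x y : `|w| = 1 -> gamma w (x * y) = gamma w x * gamma w y.
Proof. by case: gammaP => aut _ _ _ /aut[]. Qed.

Lemma gauge_star w x : `|w| = 1 -> gamma w (star x) = star (gamma w x).
Proof. by case: gammaP => aut _ _ _ /aut[]. Qed.

Lemma gauge1 w : `|w| = 1 -> gamma w 1 = 1.
Proof. by case: gammaP => aut _ _ _ /aut[]. Qed.

Lemma gaugeD w x y : `|w| = 1 -> gamma w (x + y) = gamma w x + gamma w y.
Proof. by move=> w1; rewrite -[x]scale1r gauge_linear // !scale1r. Qed.

Lemma gauge0 w : `|w| = 1 -> gamma w 0 = 0.
Proof. by move=> w1; apply: (addrI (gamma w 0)); rewrite -gaugeD // !addr0. Qed.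

Lemma gaugeZ w (c : R[i]) x : `|w| = 1 -> gamma w (c *: x) = c *: gamma w x.
Proof. by move=> w1; rewrite -[c *: x]addr0 gauge_linear // gauge0 // addr0. Qed.

Lemma nm_gauge w x : `|w| = 1 -> nm (gamma w x) <= 2 * nm x.
Proof.
by case: gammaP => aut _ _ _ /aut[_ L g1 M s]; apply: star_hom_bound.
Qed.

Lemma gauge_Sw w a (v : word n a) : `|w| = 1 -> gamma w (Sw S v) = w ^+ a *: Sw S v.
Proof.
move=> w1; elim: a v => [v|a IH [v i]]; first by rewrite /= gauge1 // scale1r.
 rewrite /= gaugeM // IH; have [_ _ _ ->] := gammaP => //.
by rewrite -scalerAr -scalerAl scalerA exprS.
Qed.

Lemma gauge_homogeneous w k x : `|w| = 1 -> homogeneous S k x -> gamma w x = w ^ k *: x.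
Proof.
move=> w1 [a [b [-> /(words_expansion OnS)[c ->]]]].
have w0 : w != 0 by rewrite -normr_eq0 w1 oner_eq0.
have gsum (I : finType) (f : I -> A) : gamma w (\sum_i f i) = \sum_i gamma w (f i).
  by elim/big_rec2: _ => [|i u v _ <-]; rewrite ?gauge0 // gaugeD.
rewrite gsum scaler_sumr; apply: eq_bigr => u _.
rewrite gsum scaler_sumr; apply: eq_bigr => v _.
rewrite gaugeZ // gaugeM // gauge_star // !gauge_Sw // starZ rmorphXn /=.
rewrite conj_unimodular // -scalerAl -scalerAr !scalerA expfzDr // -exprnN.
by rewrite -mulrA mulrC exprVn.
Qed.

Let W m (j : nat) : R[i] := root_2pow m ^+ j.

Let W1 m j : `|W m j| = 1. Proof. exact: root_2pow_norm. Qed.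

Let W0 m j : W m j != 0. Proof. by rewrite -normr_eq0 W1 oner_eq0. Qed.

(* A Riemann sum for the integral of h(z) gamma_z(x) over the circle. *)
Definition riemann m (h : nat -> R[i]) x : A :=
  ((2 ^ m)%:R)^-1 *: \sum_(j < 2 ^ m) h j *: gamma (W m j) x.

Lemma riemannL m h (c : R[i]) x y :
  riemann m h (c *: x + y) = c *: riemann m h x + riemann m h y.
Proof.
rewrite /riemann scalerA (mulrC c) -scalerA -scalerDr; congr (_ *: _).
rewrite scaler_sumr -big_split; apply: eq_bigr => j _ /=.
by rewrite gauge_linear // scalerDr !scalerA mulrC.
Qed.

Lemma riemannD m h x y : riemann m h (x + y) = riemann m h x + riemann m h y.
Proof. by rewrite -[x]scale1r riemannL !scale1r. Qed.

Lemma riemannB m h x y : riemann m h (x - y) = riemann m h x - riemann m h y.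
Proof. by rewrite addrC -[- y]scaleN1r riemannL scaleN1r addrC. Qed.

Lemma riemann0 m h : riemann m h 0 = 0.
Proof. by apply: (addrI (riemann m h 0)); rewrite -riemannD !addr0. Qed.

Lemma nm_riemann m (h : nat -> R[i]) x (K : R) : \sum_(j < 2 ^ m) nm (h j) <= (2 ^ m)%:R * K ->
  nm (riemann m h x) <= K * (2 * nm x).
Proof.
move=> hK; have M0 : 0 < (2 ^ m)%:R :> R by rewrite ltr0n expn_gt0.
rewrite nmZ nm_scalarV nm_nat ler_pdivrMl // (mulrA _ K).
apply: le_trans (nm_sum _ _ _) _.
have x0 : 0 <= 2 * nm x by have := nm_ge0 x; lra.
apply: (le_trans _ (ler_wpM2r x0 hK)); rewrite mulr_suml; apply: ler_sum => j _.
by rewrite nmZ ler_wpM2l ?nm_ge0 // nm_gauge.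
Qed.

Lemma riemann_homogeneous m (h : nat -> R[i]) l x : homogeneous S l x ->
  riemann m h x = (((2 ^ m)%:R)^-1 * \sum_(j < 2 ^ m) h j * W m j ^ l) *: x.
Proof.
move=> lx; rewrite -scalerA; congr (_ *: _); rewrite scaler_suml.
by apply: eq_bigr => j _; rewrite (gauge_homogeneous _ lx) // scalerA.
Qed.

Definition fourier m k := riemann m (fun j => W m j ^ (- k)).

Lemma nm_fourier m k x : nm (fourier m k x) <= 2 * nm x.
Proof.
rewrite -[leRHS]mul1r; apply: nm_riemann.
rewrite (eq_bigr (fun=> 1)) => [|j _]; first by rewrite sumr_const card_ord mulr1.
by rewrite /nm unimodular_exprz.
Qed.

Lemma fourier_homogeneous m k l x : homogeneous S l x -> (`|l - k| < 2 ^ m)%N ->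
  fourier m k x = if l == k then x else 0.
Proof.
move=> lx lk; rewrite /fourier (riemann_homogeneous _ _ lx).
under eq_bigr => j _ do rewrite -expfzDr // addrC.
rewrite (root_sum (root_2powP m)) // subr_eq0; case: eqP => _; last by rewrite mulr0 scale0r.
by rewrite mulVf ?scale1r // pnatr_eq0 expn_eq0.
Qed.

(** [y] does not depend on [m]: once 2^m exceeds L + |k| there is no aliasing between degrees. *)
Lemma fourier_polynomial L k x : graded_sum S L x -> exists2 y, homogeneous S k y &
  forall m, (L + `|k| < 2 ^ m)%N -> fourier m k x = y.
Proof.
elim=> [|l u v lL lu _ [y ky yE]].
  by exists 0; [apply: homogeneous0|move=> m _; apply: riemann0].
exists ((if l == k then u else 0) + y).
  apply: homogeneousD => //; case: eqP => [<- //|_]; exact: homogeneous0.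
move=> m Lm; rewrite /fourier riemannD -!/(fourier m k _) yE //.
by rewrite (fourier_homogeneous lu) //; lia.
Qed.

Lemma ltn_2expl (M m : nat) : (M <= m)%N -> (M < 2 ^ m)%N.
Proof. by move=> Mm; apply: leq_trans (ltn_expl m (isT : 1 < 2)%N). Qed.

(** The sums are eventually constant on polynomials and bounded by 2 |x| uniformly in [m], so they
    are Cauchy by density. A polynomial within e / 5 leaves two errors of at most 2 e / 5. *)
Lemma coefficient_exists k x : exists y, tends (fun m => fourier m k x) y.
Proof.
apply: cauchy_tends => e e0; have e5 : 0 < e / 5 by lra.
have [y [L yL] xy] := polynomial_dense OnS x e5.
have [y' _ yE] := fourier_polynomial k yL.
exists (L + `|k|)%N => m m' Lm Lm'.
have near_y' j : (L + `|k| <= j)%N -> nm (fourier j k x - y') <= 2 * nm (x - y).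
  by move=> /ltn_2expl /yE <-; rewrite -riemannB nm_fourier.
have := near_y' _ Lm; have := near_y' _ Lm'.
have := nm_trans (fourier m k x) y' (fourier m' k x); rewrite (nmB y'); lra.
Qed.

Definition coefficient k x := sval (cid (coefficient_exists k x)).

Lemma coefficientP k x : tends (fun m => fourier m k x) (coefficient k x).
Proof. exact: svalP (cid (coefficient_exists k x)). Qed.

Lemma coefficientL k (c : R[i]) x y :
  coefficient k (c *: x + y) = c *: coefficient k x + coefficient k y.
Proof.
apply: (tends_uniq (coefficientP k _)); under eq_fun do rewrite /fourier riemannL.
by apply: tendsD; [apply: tendsZ|]; apply: coefficientP.
Qed.

Lemma coefficientB k x y : coefficient k (x - y) = coefficient k x - coefficient k y.
Proof. by rewrite addrC -[- y]scaleN1r coefficientL scaleN1r addrC. Qed.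

Lemma nm_coefficient k x : nm (coefficient k x) <= 2 * nm x.
Proof. by apply: tends_bound (coefficientP k x) => m; apply: nm_fourier. Qed.

Lemma coefficient_approached k l x : approached (homogeneous S l) x ->
  coefficient k x = if l == k then x else 0.
Proof.
move=> lx; apply/eqP; rewrite -subr_eq0; apply/eqP/nm_small => e e0.
have e4 : 0 < e / 4 by lra.
have [y ly xy] := lx _ e4.
have yE : coefficient k y = if l == k then y else 0.
  apply: (tends_uniq (coefficientP k y)).
  apply: (tends_eventually (M := `|l - k|)) => m /ltn_2expl lk.
  exact: fourier_homogeneous.
have -> : coefficient k x - (if l == k then x else 0)
    = coefficient k (x - y) - (if l == k then x - y else 0).
  by rewrite coefficientB yE; case: eqP => _; rewrite ?subr0 // opprB addrA subrK.
apply: le_lt_trans (nmD _ _) _; rewrite nmN; have := nm_coefficient k (x - y).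
by case: eqP => _; rewrite ?nm0; have := nm_ge0 (x - y); lra.
Qed.

Lemma coefficient_homogeneous k x : approached (homogeneous S k) (coefficient k x).
Proof.
move=> e e0; have e4 : 0 < e / 4 by lra.
have [y [L yL] xy] := polynomial_dense OnS x e4.
have [y' ky' yE] := fourier_polynomial k yL; exists y' => //.
have -> : y' = coefficient k y.
  apply: tends_uniq (coefficientP k y).
  by apply: (tends_eventually (M := (L + `|k|)%N)) => m /ltn_2expl /yE.
by rewrite -coefficientB; have := nm_coefficient k (x - y); lra.
Qed.

Local Notation Fn := (fixed_point_algebra gamma).

(** Linearity over F_n keeps coefficients in the relative commutant and in the corners cut out by
    projections fixed by the gauge action. *)
Lemma coefficientMl k a x : Fn a -> coefficient k (a * x) = a * coefficient k x.
Proof.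
move=> aF; apply: (tends_uniq (coefficientP k _)).
rewrite (_ : (fun m => _) = fun m => a * fourier m k x); first exact/tendsMl/coefficientP.
apply/funext => m; rewrite /fourier /riemann -scalerAr mulr_sumr; congr (_ *: _).
by apply: eq_bigr => j _; rewrite gaugeM // aF // scalerAr.
Qed.

Lemma coefficientMr k a x : Fn a -> coefficient k (x * a) = coefficient k x * a.
Proof.
move=> aF; apply: (tends_uniq (coefficientP k _)).
rewrite (_ : (fun m => _) = fun m => fourier m k x * a); first exact/tendsMr/coefficientP.
apply/funext => m; rewrite /fourier /riemann -scalerAl mulr_suml; congr (_ *: _).
by apply: eq_bigr => j _; rewrite gaugeM // aF // scalerAl.
Qed.

Lemma approached_fixed x : approached (homogeneous S 0) x -> Fn x.
Proof.
move=> x0 w w1; apply/eqP; rewrite -subr_eq0; apply/eqP/nm_small => e e0.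
have e4 : 0 < e / 4 by lra.
have [y y0 xy] := x0 _ e4.
have -> : gamma w x - x = gamma w (x - y) - (x - y).
  rewrite gaugeD // -[- y]scaleN1r gaugeZ // (gauge_homogeneous w1 y0) expr0z scale1r.
  by rewrite scaleN1r opprB addrA subrK.
apply: le_lt_trans (nmD _ _) _; rewrite nmN.
by have := nm_gauge (x - y) w1; have := nm_ge0 (x - y); lra.
Qed.

(** Every Fourier sum of degree 0 of a fixed [x] is [x] itself, so [x] equals its coefficient of
    degree 0. *)
Lemma fixed_approached x : Fn x -> approached (homogeneous S 0) x.
Proof.
move=> xF; have {1}-> : x = coefficient 0 x; last exact: coefficient_homogeneous.
apply: tends_uniq (coefficientP 0 x); apply: (tends_eventually (M := 0)) => m _.
rewrite /fourier /riemann; under eq_bigr => j _ do rewrite xF // oppr0 expr0z scale1r.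
rewrite sumr_const card_ord -[x *+ _](@scaler_nat R[i]) scalerA mulVf ?scale1r //.
Qed.
End Fourier.

(** * Elements with vanishing Fourier coefficients *)

Section Uniqueness.
Context {R : realType} {A : cstarAlgType R} (n : nat) (S : 'I_n -> A).
Hypothesis OnS : cuntz_algebra S.
Variable gamma : R[i] -> A -> A.
Hypothesis gammaP : gauge_action S gamma.
Implicit Types (x y z : A) (k l : int) (w : R[i]).

Let W m (j : nat) : R[i] := root_2pow m ^+ j.

Let W1 m j : `|W m j| = 1. Proof. exact: root_2pow_norm. Qed.

Let W0 m j : W m j != 0. Proof. by rewrite -normr_eq0 W1 oner_eq0. Qed.

(* The kernel is D_(3L+2) conj(D_(L+1)) / (L+1), shifted, D_K being the sum of
   the first K powers: its coefficients are 1 in degrees -L .. L, and its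
   L^1 norm is at most 2 by AM-GM and Parseval. *)
Definition kernel L m (j : nat) : R[i] :=
  (L.+1%:R)^-1 * \sum_(a < (3 * L).+2) \sum_(b < L.+1) W m j ^ (- (a%:Z - L%:Z - b%:Z)).

Lemma kernel_riemann L m x : riemann gamma m (kernel L m) x =
  (L.+1%:R)^-1 *: \sum_(a < (3 * L).+2) \sum_(b < L.+1) fourier gamma m (a%:Z - L%:Z - b%:Z) x.
Proof.
rewrite /fourier /riemann.
under [X in _ = _ *: X]eq_bigr => a _ do rewrite -scaler_sumr exchange_big.
rewrite -scaler_sumr exchange_big scalerA mulrC -scalerA; congr (_ *: _).
rewrite scaler_sumr; apply: eq_bigr => j _; rewrite -scalerA; congr (_ *: _).
by rewrite scaler_suml; apply: eq_bigr => a _; rewrite scaler_suml.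
Qed.

Lemma kernel_bound L m : ((3 * L).+2 <= 2 ^ m)%N ->
  \sum_(j < 2 ^ m) nm (kernel L m j) <= (2 ^ m)%:R * 2.
Proof.
move=> Lm.
pose D K (j : nat) : R[i] := \sum_(a < K) W m j ^+ a.
have nmW j k : nm (W m j ^ k) = 1 by rewrite /nm unimodular_exprz.
have kE j : nm (kernel L m j) = (L.+1%:R)^-1 * (nm (D (3 * L).+2 j) * nm (D L.+1 j)).
  rewrite /kernel nm_scalarM nm_scalarV nm_nat; congr (_ * _).
  have -> : \sum_(a < (3 * L).+2) \sum_(b < L.+1) W m j ^ (- (a%:Z - L%:Z - b%:Z))
      = W m j ^ L%:Z * ((D (3 * L).+2 j)^*%R * D L.+1 j).
    rewrite rmorph_sum mulr_suml mulr_sumr; apply: eq_bigr => a _.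
    rewrite !mulr_sumr; apply: eq_bigr => b _.
    rewrite rmorphXn /= conj_unimodular // !opprB addrCA !expfzDr // -exprnN exprVn.
    by congr (_ * _); apply: mulrC.
  by rewrite !nm_scalarM nmW mul1r nm_conj.
under eq_bigr => j _ do rewrite kE.
rewrite -mulr_sumr ler_pdivrMl ?ltr0Sn //.
have P1 := root_norm_sum (root_2powP m) Lm.
have P2 := root_norm_sum (root_2powP m) (leq_trans (ltac:(lia) : (L.+1 <= (3 * L).+2)%N) Lm).
(* AM-GM and Parseval leave 2^m (3 L + 2 + L + 1) / 2, and (4 L + 3) / 2 <= 2 (L + 1). *)
apply: (@le_trans _ _ ((\sum_(j < 2 ^ m) nm (D (3 * L).+2 j) ^+ 2 + \sum_(j < 2 ^ m) nm (D L.+1 j) ^+ 2) / 2)).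
  rewrite -big_split mulr_suml; apply: ler_sum => j _ /=.
  by have := sqr_ge0 (nm (D (3 * L).+2 j) - nm (D L.+1 j)); rewrite sqrrB; lra.
rewrite P1 P2 !natrM.
have M0 : 0 <= (2 ^ m)%:R :> R by rewrite ler0n.
have K1 : ((3 * L).+2)%:R = 3 * L%:R + 2 :> R by rewrite -!natr1 natrM; lra.
by rewrite K1 -[L.+1%:R]natr1; have := mulr_ge0 M0 (ler0n R L); lra.
Qed.

Lemma kernel_homogeneous L m l x : (6 * L + 2 <= 2 ^ m)%N -> (`|l| <= L)%N ->
  homogeneous S l x -> riemann gamma m (kernel L m) x = x.
Proof.
move=> Lm lL lx; rewrite kernel_riemann exchange_big /=.
rewrite (eq_bigr (fun=> x)) => [|b _].
  by rewrite sumr_const card_ord -[x *+ _](@scaler_nat R[i]) scalerA mulVf ?scale1r.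
have bL := ltn_ord b.
(* For each [b] a single [a], namely l + L + b, meets the degree [l]; it lies between 0 and 3 L. The
   [L.+1] values of [b] cancel the normalization, and 2^m >= 6 L + 2 excludes aliasing. *)
have aL : (absz (l + L%:Z + b%:Z)%R < (3 * L).+2)%N by lia.
have fE (a : 'I_(3 * L).+2) : fourier gamma m (a%:Z - L%:Z - b%:Z) x
    = if l == a%:Z - L%:Z - b%:Z then x else 0.
  by apply: (fourier_homogeneous OnS gammaP lx); have := ltn_ord a; lia.
rewrite (bigD1 (Ordinal aL)) // fE big1 ?addr0 => [|a aN].
  by rewrite /= ifT ?addr0 //; lia.
rewrite fE; case: eqP => // le; case/eqP: aN; apply: val_inj => /=; lia.
Qed.

Lemma kernel_polynomial L m x : (6 * L + 2 <= 2 ^ m)%N -> graded_sum S L x ->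
  riemann gamma m (kernel L m) x = x.
Proof.
move=> Lm; elim=> [|k u v kL ku _ IH]; first exact: (riemann0 gammaP).
by rewrite (riemannD gammaP) IH (kernel_homogeneous Lm kL ku).
Qed.

(** For a fixed [L] the kernel sums of [x] combine finitely many Fourier sums, so they tend to 0.
    They fix a polynomial [y] near [x] exactly and are bounded by 2 * 2 = 4, one factor from
    [kernel_bound] and one from the automorphisms; so [y], and with it [x], is small. *)
Lemma coefficients_eq0 x : (forall k, coefficient OnS gammaP k x = 0) -> x = 0.
Proof.
move=> x0; apply: nm_small => e e0; have e10 : 0 < e / 10 by lra.
have [y [L yL] xy] := polynomial_dense OnS x e10.
have lim0 : tends (fun m => riemann gamma m (kernel L m) x) 0.
  under eq_fun do rewrite kernel_riemann.
  have lim a b := coefficientP OnS gammaP (a%:Z - L%:Z - b%:Z) x.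
  have z : L.+1%:R^-1 *: \sum_(a < (3 * L).+2) \sum_(b < L.+1)
      coefficient OnS gammaP (a%:Z - L%:Z - b%:Z) x = 0.
    by rewrite big1 ?scaler0 // => a _; rewrite big1 // => b _; apply: x0.
  suff h : tends (fun m => L.+1%:R^-1 *: \sum_(a < (3 * L).+2) \sum_(b < L.+1)
      fourier gamma m (a%:Z - L%:Z - b%:Z) x) (L.+1%:R^-1 *: \sum_(a < (3 * L).+2)
      \sum_(b < L.+1) coefficient OnS gammaP (a%:Z - L%:Z - b%:Z) x) by rewrite z in h.
  by apply: tendsZ; apply: tends_sum => a; apply: tends_sum => b; apply: lim.
have [M xM] := lim0 _ e10; pose m := (M + (6 * L + 2))%N.
have Lm : (6 * L + 2 <= 2 ^ m)%N.
  by apply: leq_trans (ltnW (ltn_expl m (isT : 1 < 2)%N)); apply: leq_addl.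
have := xM m (leq_addr _ _); rewrite subr0.
have Km : ((3 * L).+2 <= 2 ^ m)%N by lia.
have := nm_riemann gammaP (y - x) (kernel_bound Km).
rewrite (riemannB gammaP) (kernel_polynomial Lm yL) => yx xm.
have := nm_trans y (riemann gamma m (kernel L m) x) 0; have := nm_trans x y 0.
by rewrite !subr0; move: yx; rewrite (nmB y x); lra.
Qed.
End Uniqueness.

(** * Corners of the relative commutant *)

Section Corners.
Context {R : realType} {On : cstarAlgType R} (n : nat) (S : 'I_n -> On).
Hypothesis n_ge2 : (2 <= n)%N.
Hypothesis OnS : cuntz_algebra S.
Variable gamma : R[i] -> On -> On.
Hypothesis gammaP : gauge_action S gamma.
Variable A : set On.
Hypothesis A_star : forall x, A x -> A (star x).
Hypothesis A_Fn : A `<=` fixed_point_algebra gamma.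
Implicit Types (x y z : On) (k l : int).

Local Notation Fn := (fixed_point_algebra gamma).
Local Notation B0 := (relative_commutant A Fn).
Local Notation B := (relative_commutant A [set: On]).
Let N : R[i] := n%:R.
Let n_gt0 : (0 < n)%N. Proof. exact: ltnW. Qed.

Lemma commutant_algebra (C : set On) :
  unital_star_algebra C -> unital_star_algebra (relative_commutant A C).
Proof.
move=> [C1 CL CM Cs]; split.
- by split=> // a _; rewrite mulr1 mul1r.
- move=> c x y [Cx xA] [Cy yA]; split; first exact: CL.
  by move=> a Aa; rewrite mulrDl mulrDr -scalerAl -scalerAr xA // yA.
- move=> x y [Cx xA] [Cy yA]; split; first exact: CM.
  by move=> a Aa; rewrite -mulrA yA // mulrA xA // mulrA.
- move=> x [Cx xA]; split; first exact: Cs.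
  by move=> a /A_star Aa; rewrite -[a]starK -!starM xA.
Qed.

Lemma fixed_algebra : unital_star_algebra Fn.
Proof.
split.
- by move=> w w1; rewrite (gauge1 gammaP).
- by move=> c x y xF yF w w1; rewrite (gauge_linear gammaP) // xF // yF.
- by move=> x y xF yF w w1; rewrite (gaugeM gammaP) // xF // yF.
- by move=> x xF w w1; rewrite (gauge_star gammaP) // xF.
Qed.

Let B0_alg : unital_star_algebra B0. Proof. exact/commutant_algebra/fixed_algebra. Qed.
Let B_alg : unital_star_algebra B. Proof. exact: commutant_algebra. Qed.

Variables (r : nat) (p : 'I_r -> On).
Hypothesis pF : complete_family B0 p.
Hypothesis p_min : forall i x, B0 x -> exists c : R[i], p i * x * p i = c *: p i.

Definition spectral_corner i j k x :=
  [/\ B x, approached (homogeneous S k) x, p i * x = x & x * p j = x].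

Lemma spectral_corner_star i j k x :
  spectral_corner i j k x -> spectral_corner j i (- k) (star x).
Proof.
case: pF => _ pP _ _ _ [Bx xk ix xj]; split.
- by case: B_alg => _ _ _; apply.
- by apply: approached_star xk => y; apply: homogeneous_star.
- by rewrite -{1}(pP j).1 -starM xj.
- by rewrite -{1}(pP i).1 -starM ix.
Qed.

Lemma spectral_corner_mul i j k x y : spectral_corner i j k x ->
  spectral_corner j i (- k) y -> exists c : R[i], x * y = c *: p i.
Proof.
move=> [Bx xk ix xj] [By yk jy yi].
have [c cE] : exists c : R[i], p i * (x * y) * p i = c *: p i.
  apply: p_min; split.
    apply: (approached_fixed OnS gammaP); apply: approached_mul xk yk => u v uk vk.
    by rewrite -[0](subrr k); apply: (homogeneous_mul OnS).
  by case: B_alg => _ _ /(_ _ _ Bx By)[].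
by exists c; rewrite -cE mulrA ix -mulrA yi.
Qed.

Lemma spectral_corner_unitary i j k x : spectral_corner i j k x -> x != 0 ->
  exists2 c : R[i], c != 0 & x * star x = c *: p i /\ star x * x = c *: p j.
Proof.
move=> xC x0; have xsC := spectral_corner_star xC.
have [c cE] := spectral_corner_mul xC xsC.
have [d dE] : exists d : R[i], star x * x = d *: p j.
  by apply: (spectral_corner_mul xsC); rewrite opprK.
have [_ _ ix xj] := xC.
(* x x^* x is evaluated in two ways. *)
have cd : c = d.
  apply/eqP; rewrite -subr_eq0; have : (c - d) *: x == 0.
    by rewrite scalerBl -{1}ix -{2}xj scalerAl -cE scalerAr -dE mulrA subrr.
  by rewrite scaler_eq0 (negPf x0) orbF.
exists c; last by rewrite {2}cd.
apply: contraNneq x0 => c0; apply/eqP/nm_eq0/eqP.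
by rewrite -sqrf_eq0 -nm_cstar dE -cd c0 scale0r nm0.
Qed.

Lemma spectral_corner_null i j k x : spectral_corner i j k x -> x != 0 ->
  null S (p i - N ^ (- k) *: p j).
Proof.
move=> xC x0; have [c c0 [cE dE]] := spectral_corner_unitary xC x0.
have [_ xk _ _] := xC; have [_ xsk _ _] := spectral_corner_star xC.
have := kms OnS n_gt0 xk xsk; rewrite cE dE => cN.
have null0 : null S 0 by move=> e e0; exists 0%N; rewrite /= nm0.
have := null_linear OnS n_gt0 c^-1 cN null0.
by rewrite addr0 scalerBr !scalerA mulVf // scale1r mulrAC mulVf // mul1r.
Qed.

Lemma spectral_corner_degree i j k l x y : spectral_corner i j k x -> x != 0 ->
  spectral_corner i j l y -> y != 0 -> k = l.
Proof.
move=> xC x0 yC y0; apply/eqP/negPn/negP => kl.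
have xN := spectral_corner_null xC x0; have yN := spectral_corner_null yC y0.
have [Bp pP p0 _ _] := pF.
(* n >= 2 makes k |-> n^k injective, seen in the ordered field [R] and transported to [R[i]]. The
   difference of the two null relations is then a nonzero multiple of [p j]. *)
have cN : N ^ (- k) - N ^ (- l) != 0.
  rewrite subr_eq0; apply: contra_neq kl => kl; apply: oppr_inj.
  apply: (@ieexprIz _ (n%:R : R)); rewrite ?ltr0n // ?pnatr_eq1 ?gtn_eqF //.
  by apply: (@complexI R); rewrite !fmorphXz /= !rmorph_nat.
apply/negP: (p0 j); rewrite negbK; apply/eqP.
apply: (null_projection OnS n_gt0 (pP j)).
  by apply: (fixed_approached OnS gammaP); case: (Bp j).
have null0 : null S 0 by move=> e e0; exists 0%N; rewrite /= nm0.
have := null_linear OnS n_gt0 (N ^ (- k) - N ^ (- l))^-1 (null_linear OnS n_gt0 (-1) xN yN) null0.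
by rewrite addr0 scaleN1r opprB addrA subrK -scalerBl scalerA mulVf // scale1r.
Qed.

Lemma coefficient_corner i j k x : B x -> p i * x = x -> x * p j = x ->
  spectral_corner i j k (coefficient OnS gammaP k x).
Proof.
move=> [_ xA] ix xj; have [Bp _ _ _ _] := pF; split.
- split=> // a Aa; have aF := A_Fn Aa.
  by rewrite -coefficientMr // xA // coefficientMl.
- exact: coefficient_homogeneous.
- by rewrite -coefficientMl ?ix //; case: (Bp i).
- by rewrite -coefficientMr ?xj //; case: (Bp j).
Qed.

(** Let z be the degree k coefficient of x. Then w^* z is a multiple of p_j, and w w^* z = c z makes
    z a multiple of w; all other coefficients of x vanish because a corner supports a single
    degree. *)
Lemma corner_line i j : exists2 w, B w &
  forall x, B x -> p i * x = x -> x * p j = x -> exists c : R[i], x = c *: w.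
Proof.
have [[k [w [wC w0]]]|none] := pselect (exists k w, spectral_corner i j k w /\ w != 0).
  exists w; first by case: wC.
  move=> x Bx ix xj; pose z := coefficient OnS gammaP k x.
  have zC : spectral_corner i j k z by apply: coefficient_corner.
  have [c c0 [cE _]] := spectral_corner_unitary wC w0.
  have [d dE] : exists d : R[i], star w * z = d *: p j.
    by apply: (spectral_corner_mul (spectral_corner_star wC)); rewrite opprK.
  have zE : z = (c^-1 * d) *: w.
    have [_ _ iz _] := zC; have [_ wk _ wj] := wC.
    rewrite -scalerA -[in RHS]wj scalerAr -dE mulrA cE -scalerAl iz scalerA.
    by rewrite mulVf ?scale1r.
  exists (c^-1 * d); apply/eqP; rewrite -subr_eq0; apply/eqP.
  apply: (coefficients_eq0 (OnS := OnS) (gammaP := gammaP)) => l.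
  have [_ wk _ _] := wC.
  rewrite -scaleNr addrC coefficientL (coefficient_approached OnS gammaP l wk).
  case: eqP => [<-|/eqP kl]; first by rewrite -/z zE scaleNr addNr.
  rewrite scaler0 add0r; apply/eqP/negPn/negP => xl.
  have lC := coefficient_corner l Bx ix xj.
  by move: kl; rewrite (spectral_corner_degree wC w0 lC xl) eqxx.
(* All spectral corners vanish, so the corner itself is 0 and 0 spans it. *)
exists 0; first exact: star_algebra0 B_alg.
move=> x Bx ix xj; exists 0; rewrite scale0r.
apply: (coefficients_eq0 (OnS := OnS) (gammaP := gammaP)) => k; apply/eqP/negPn/negP => xk.
by apply: none; exists k, (coefficient OnS gammaP k x); split => //; apply: coefficient_corner.
Qed.

Lemma commutant_finite_dimensional : finite_dimensional B.
Proof.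
have [w Bw wE] : exists2 w : 'I_r * 'I_r -> On, forall ij, B (w ij) &
    forall ij x, B x -> p ij.1 * x = x -> x * p ij.2 = x -> exists c : R[i], x = c *: w ij.
  have line ij : exists w, B w /\ forall x, B x -> p ij.1 * x = x -> x * p ij.2 = x ->
      exists c : R[i], x = c *: w.
    by have [w Bw wE] := corner_line ij.1 ij.2; exists w.
  by have [w wP] := choice line; exists w => ij; case: (wP ij).
have [Bp pP _ _ p1] := pF.
have BpB i : B (p i) by case: (Bp i).
(* [finite_dimensional] asks for equality with a span, hence each [w ij] was chosen inside the
   commutant. *)
exists #|{: 'I_r * 'I_r}|, (fun q : 'I_#|{: 'I_r * 'I_r}| => w (enum_val q)); apply/seteqP; split; last first.
  by move=> _ [c _ <-]; apply: (star_algebra_sum B_alg) => k; apply: (star_algebraZ B_alg).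
move=> x Bx; have [_ _ BM _] := B_alg.
have pc ij : exists c : R[i], p ij.1 * x * p ij.2 = c *: w ij.
  apply: wE; first by apply: (BM) => //; apply: BM.
    by rewrite !mulrA (pP _).2.
  by rewrite -!mulrA (pP _).2.
have [c cE] := choice pc.
exists (fun q => c (enum_val q)) => //.
transitivity (\sum_ij c ij *: w ij).
  by rewrite [RHS](reindex _ (onW_bij _ (enum_val_bij _))).
under eq_bigr => ij _ do rewrite -cE.
rewrite -(pair_bigA _ (fun i j => p i * x * p j)) /=.
under eq_bigr => i _ do rewrite -mulr_sumr p1 mulr1.
by rewrite -mulr_suml p1 mul1r.
Qed.
End Corners.

Theorem theorem2p1 (R : realType) (n : nat) (n_ge2 : (2 <= n)%N)
    (On : cstarAlgType R) (S : 'I_n -> On) (OnS : cuntz_algebra S)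
    (gamma : R[i] -> On -> On) (gammaP : gauge_action S gamma)
    (A : set On) (A_sub : cstar_subalgebra A)
    (A_Fn : A `<=` fixed_point_algebra gamma) :
  finite_dimensional (relative_commutant A (fixed_point_algebra gamma)) ->
  finite_dimensional (relative_commutant A [set: On]).
Proof.
have [_ _ _ _ A_star] := A_sub.
move=> [d [v vE]].
have B0_alg := commutant_algebra A_star (fixed_algebra gammaP).
have B0_span x : relative_commutant A (fixed_point_algebra gamma) x -> in_span v x.
  by rewrite vE => -[c _ <-]; exists c.
have [r [p [pF p_min]]] := minimal_projections B0_alg B0_span.
exact: (commutant_finite_dimensional n_ge2 OnS gammaP A_star A_Fn pF p_min).
Qed.
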